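(* Let $X$ be a reduced lattice, let $m(X)$ be its set of minimal elements, and let $V$ be a finite set with $m(X)\subseteq V$. Let $n=\#V$ and let $X^*$ be the Alexander dual of $X$ with respect to $V$. Then for any $i$, $$\tilde H_i(X)\cong \tilde H^{\,n-i-3}(X^* ).$$
   Context: Finite simplicial complexes are abstract: a finite family of finite sets closed under taking subsets; the empty set is regarded as a simplex of every simplicial complex. For a finite simplicial complex $K$ with vertex set contained in a finite set $V$, the Alexander dual of $K$ with respect to $V$ is $K^*=\{\sigma\subseteq V : V\smallsetminus\sigma\notin K\}$. The face poset $\mathcal{X}(K)$ is the poset of non-empty simplices of $K$ ordered by inclusion. A reduced lattice is a finite poset $X$ in which every non-empty subset that is bounded below has an infimum. $m(X)$ denotes the set of minimal elements of $X$. $T(X)$ is the simplicial complex whose vertex set is $m(X)$ and whose simplices are the subsets of $m(X)$ that are bounded above in $X$ (together with the empty simplex). Given a finite set $V\supseteq m(X)$, the Alexander dual of $X$ with respect to $V$ is the reduced lattice $X^*=\mathcal{X}(T(X)^* )$, where $T(X)^*$ is the Alexander dual of the simplicial complex $T(X)$ with respect to $V$. The (co)homology of a finite poset is the (co)homology of its order complex, i.e. the simplicial complex whose simplices are the non-empty chains of the poset. $\tilde H_i$ and $\tilde H^i$ denote reduced homology and reduced cohomology.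
   Formalization: When V itself is a simplex of T(X), the degree i = n-2 is excluded (and also i = -1 if n = 0): there X* is empty with reduced cohomology Z in degree -1, and exactly one side is Z while the other is 0, so the claim as stated is false. *)

(* Defs.v *)
From HB Require Import structures.
From mathcomp Require Import all_boot all_order all_algebra.
From mathcomp Require Import boolp.

Set Implicit Arguments.
Unset Strict Implicit.
Unset Printing Implicit Defensive.

Import Order.TTheory GRing.Theory Num.Theory.
Import Order.DefaultSetSubsetOrder.
Local Open Scope ring_scope.

(* ker g / (im f :&: ker g), for f : U -> V and g : V -> W; this is the usual
   ker g / im f whenever g \o f = 0. *)

Definition kernel (V W : zmodType) (g : {additive V -> W}) : {pred V} :=
  [pred x | g x == 0].

Fact kernel_zmod_closed (V W : zmodType) (g : {additive V -> W}) :
  zmod_closed (kernel g).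
Proof.
split=> [|x y]; rewrite !inE ?raddf0 // => /eqP gx /eqP gy.
by rewrite raddfB gx gy subrr.
Qed.

HB.instance Definition _ (V W : zmodType) (g : {additive V -> W}) :=
  GRing.isZmodClosed.Build V (kernel g) (kernel_zmod_closed g).

Definition cycles (V W : zmodType) (g : {additive V -> W}) : Type :=
  {x : V | x \in kernel g}.

HB.instance Definition _ (V W : zmodType) (g : {additive V -> W}) :=
  SubChoice.on (cycles g).
HB.instance Definition _ (V W : zmodType) (g : {additive V -> W}) :=
  [SubChoice_isSubZmodule of cycles g by <:].

Definition boundaries (U V W : zmodType) (f : {additive U -> V})
    (g : {additive V -> W}) : {pred cycles g} :=
  [pred z | `[< exists b : U, f b = val z >]].
Arguments boundaries {U V W} f g.

Fact boundaries_zmod_closed (U V W : zmodType) (f : {additive U -> V})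
    (g : {additive V -> W}) : zmod_closed (boundaries f g).
Proof.
split=> [|x y]; rewrite !inE; first by apply/asboolP; exists 0; rewrite !raddf0.
move=> /asboolP[a fa] /asboolP[b fb]; apply/asboolP; exists (a - b).
by rewrite !raddfB fa fb.
Qed.

HB.instance Definition _ (U V W : zmodType) (f : {additive U -> V})
    (g : {additive V -> W}) :=
  GRing.isZmodClosed.Build (cycles g) (boundaries f g)
    (boundaries_zmod_closed f g).

Definition homology (U V W : zmodType) (f : {additive U -> V})
    (g : {additive V -> W}) : zmodType :=
  Quotient.quot (boundaries f g).

Definition isomorphic (A B : zmodType) : Prop :=
  exists f : {additive A -> B}, bijective f.

(* A simplicial complex on a finite type T of potential vertices is encoded by
   the family K : {set {set T}} of all its simplices, the empty one included.
   Degrees range over int, and the empty simplex has dimension -1, so that the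
   chain complex below is the augmented one. *)

Definition simplex (T : finType) (K : {set {set T}}) (i : int) : Type :=
  {s : {set T} | (s \in K) && (#|s|%:Z == i + 1)}.

HB.instance Definition _ (T : finType) (K : {set {set T}}) (i : int) :=
  Finite.on (simplex K i).

(* Integral chains and cochains have the same underlying group, as there are
   finitely many simplices. *)
Definition chain (T : finType) (K : {set {set T}}) (i : int) : zmodType :=
  {ffun simplex K i -> int}.

(* Coefficient of t in the boundary of s, where s and t are oriented by the
   order in which T is enumerated: (-1)^k if t is s without its k-th vertex
   (counting from 0), and 0 if t is not a facet of s. *)
Definition incidence (T : finType) (s t : {set T}) : int :=
  \sum_(x in s | t == s :\ x)
     (-1) ^+ #|[set y in s | (enum_rank y < enum_rank x)%N]|.

(* Meant for j = i - 1; leaving j free avoids casts between degrees. *)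
Definition bdry (T : finType) (K : {set {set T}}) (i j : int)
    (c : chain K i) : chain K j :=
  [ffun t : simplex K j =>
     \sum_(s : simplex K i) c s * incidence (val s) (val t)].

(* Meant for j = i + 1; the transpose of bdry. *)
Definition cobdry (T : finType) (K : {set {set T}}) (i j : int)
    (c : chain K i) : chain K j :=
  [ffun s : simplex K j =>
     \sum_(t : simplex K i) c t * incidence (val s) (val t)].

Fact bdry_is_additive (T : finType) (K : {set {set T}}) (i j : int) :
  zmod_morphism (@bdry T K i j).
Proof.
move=> c c'; apply/ffunP=> t; rewrite !ffunE -sumrB.
by apply: eq_bigr => s _; rewrite !ffunE mulrBl.
Qed.

HB.instance Definition _ (T : finType) (K : {set {set T}}) (i j : int) :=
  GRing.isZmodMorphism.Build (chain K i) (chain K j) (@bdry T K i j)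
    (@bdry_is_additive T K i j).

Fact cobdry_is_additive (T : finType) (K : {set {set T}}) (i j : int) :
  zmod_morphism (@cobdry T K i j).
Proof.
move=> c c'; apply/ffunP=> s; rewrite !ffunE -sumrB.
by apply: eq_bigr => t _; rewrite !ffunE mulrBl.
Qed.

HB.instance Definition _ (T : finType) (K : {set {set T}}) (i j : int) :=
  GRing.isZmodMorphism.Build (chain K i) (chain K j) (@cobdry T K i j)
    (@cobdry_is_additive T K i j).

Definition red_homology (T : finType) (K : {set {set T}}) (i : int) : zmodType :=
  homology (@bdry T K (i + 1) i) (@bdry T K i (i - 1)).

Definition red_cohomology (T : finType) (K : {set {set T}}) (i : int) :
    zmodType :=
  homology (@cobdry T K (i - 1) i) (@cobdry T K i (i + 1)).

Definition order_complex (d : Order.disp_t) (X : finPOrderType d) :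
    {set {set X}} :=
  [set s : {set X} | [forall x in s, forall y in s, (x >=< y)%O]].

Definition poset_red_homology (d : Order.disp_t) (X : finPOrderType d) (i : int) :
    zmodType :=
  red_homology (order_complex X) i.

Definition poset_red_cohomology (d : Order.disp_t) (X : finPOrderType d)
    (i : int) : zmodType :=
  red_cohomology (order_complex X) i.

Definition face_poset (V : finType) (K : {set {set V}}) : Type :=
  {s : {set V} | (s \in K) && (s != set0)}.

HB.instance Definition _ (V : finType) (K : {set {set V}}) :=
  SubChoice.on (face_poset K).
HB.instance Definition _ (V : finType) (K : {set {set V}}) :=
  Finite.on (face_poset K).
HB.instance Definition _ (V : finType) (K : {set {set V}}) :=
  [SubChoice_isSubPOrder of face_poset K by <: with
     Order.SetSubsetOrder.subset_display].

Definition alexander_dual (V : finType) (K : {set {set V}}) : {set {set V}} :=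
  [set s : {set V} | ~: s \notin K].

Definition lower_bound (d : Order.disp_t) (X : finPOrderType d) (A : {set X})
    (x : X) : Prop :=
  forall a, a \in A -> (x <= a)%O.

Definition infimum (d : Order.disp_t) (X : finPOrderType d) (A : {set X})
    (x : X) : Prop :=
  lower_bound A x /\ forall y, lower_bound A y -> (y <= x)%O.

Definition reduced_lattice (d : Order.disp_t) (X : finPOrderType d) : Prop :=
  forall A : {set X}, A != set0 ->
    (exists x, lower_bound A x) -> exists x, infimum A x.

Definition minimals (d : Order.disp_t) (X : finPOrderType d) : {set X} :=
  [set x : X | [forall y : X, (y <= x)%O ==> (y == x)]].

Definition minimal_elt (d : Order.disp_t) (X : finPOrderType d) : Type :=
  {x : X | x \in minimals X}.

HB.instance Definition _ (d : Order.disp_t) (X : finPOrderType d) :=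
  Finite.on (minimal_elt X).

Definition T_complex (d : Order.disp_t) (X : finPOrderType d) :
    {set {set minimal_elt X}} :=
  [set s : {set minimal_elt X} |
     (s == set0) || [exists u : X, forall x in s, (val x <= u)%O]].

(* The inclusion of the set of minimal elements of X in V is given by an
   injection incl; this is the complex above, seen on V. *)
Definition T_complex_in (d : Order.disp_t) (X : finPOrderType d) (V : finType)
    (incl : minimal_elt X -> V) : {set {set V}} :=
  [set incl @: (s : {set minimal_elt X}) | s in T_complex X].

(* If V itself is a simplex of T(X), then alexander_dual is the void family: it
   lacks even the empty simplex, hence is not a simplicial complex. Its face
   poset is the empty poset, whose order complex does contain the empty simplex,
   so that its reduced cohomology is int in degree -1. In that case, writing
   n for #|V|, Alexander duality fails for i = n - 2, as well as for i = -1 if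
   n = 0 (i.e. if X and V are empty); in all other degrees both sides are 0. *)
Definition poset_alexander_dual (d : Order.disp_t) (X : finPOrderType d)
    (V : finType) (incl : minimal_elt X -> V) :
    finPOrderType Order.SetSubsetOrder.subset_display :=
  face_poset (alexander_dual (T_complex_in incl)).

(* Main.v *)
From HB Require Import structures.
From mathcomp Require Import all_boot all_order all_algebra.
From mathcomp Require Import boolp zify ring.
Require Import Defs.

Set Implicit Arguments.
Unset Strict Implicit.
Unset Printing Implicit Defensive.

Import Order.TTheory GRing.Theory Num.Theory.
Local Open Scope ring_scope.

(* Let K be a simplicial complex on V and X a poset, related by an upward closed
   relation R between V and X such that the vertices related to an element of X
   form a non-empty simplex, and such that the elements related to all vertices
   of a given non-empty simplex have a minimum. On the disjoint union of V and X,
   consider the complex of all s + c with s in K, c a chain of X and R v x for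
   all v in s and x in c. Its simplices with c non-empty are matched by toggling
   a vertex related to min c, and those with s non-empty by toggling the minimum
   attached to s. So its subcomplexes K (where c is empty) and the order complex
   of X (where s is empty) have the same homology and cohomology. This applies
   to X and T(X), where suprema exist because X is a reduced lattice, and to the
   face poset of a complex and that complex.

   It remains to prove duality for K = T(X) and its dual. The full simplex on V
   is acyclic, so H_i(K) is the homology in degree i + 1 of the complex spanned by
   the non-simplices of K. Complementation maps these onto the simplices of the
   dual and, up to signs, the boundary to the coboundary. *)

(** * Isomorphisms of homology groups *)

Lemma isomorphic_intro (A B : zmodType) (f : A -> B) :
  zmod_morphism f -> bijective f -> isomorphic A B.
Proof.
move=> addf bijf; pose aM := GRing.isZmodMorphism.Build A B f addf.
pose F : {additive A -> B} := HB.pack f aM.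
by exists F.
Qed.

Lemma isomorphic_sym (A B : zmodType) : isomorphic A B -> isomorphic B A.
Proof.
case=> f [g fK gK]; apply: (@isomorphic_intro _ _ g); last by exists f.
by move=> x y; apply: (can_inj fK); rewrite raddfB !gK.
Qed.

Lemma isomorphic_trans (A B C : zmodType) :
  isomorphic A B -> isomorphic B C -> isomorphic A C.
Proof.
case=> f bijf [g bijg]; apply: (@isomorphic_intro _ _ (g \o f)).
  by move=> x y; rewrite /= !raddfB.
exact: bij_comp.
Qed.

Lemma trivial_isomorphic (A B : zmodType) :
  (forall x : A, x = 0) -> (forall x : B, x = 0) -> isomorphic A B.
Proof.
move=> A0 B0; apply: (@isomorphic_intro _ _ (fun=> 0)).
  by move=> x y; rewrite subrr.
by exists (fun=> 0) => x; rewrite ?[x]A0 ?[x]B0.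
Qed.

Lemma surj_inj_isomorphic (A B : zmodType) (f : A -> B) : zmod_morphism f ->
  (forall x, f x = 0 -> x = 0) -> (forall y, exists x, f x = y) ->
  isomorphic A B.
Proof.
move=> addf injf surf; apply: (isomorphic_intro addf).
exists (fun y => sval (cid (surf y))) => [x|y];
  last exact: (svalP (cid (surf y))).
apply/eqP; rewrite -subr_eq0; apply/eqP/injf; rewrite addf.
by rewrite (svalP (cid (surf (f x)))) subrr.
Qed.

(** Encapsulates the quotient: later arguments only use this projection from chains to classes. It
    sends every non-cycle to 0, so it is additive on cycles only. *)
Lemma homology_presentation (U V W : zmodType) (f : {additive U -> V})
    (g : {additive V -> W}) :
  exists pi : V -> homology f g,
    [/\ forall x y, g x = 0 -> g y = 0 -> pi (x - y) = pi x - pi y,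
        forall x, g x = 0 -> (pi x = 0 <-> exists b, f b = x) &
        forall h, exists2 x, g x = 0 & pi x = h].
Proof.
pose q (z : cycles g) : homology f g := \pi_(homology f g)%qT z.
pose pi (x : V) : homology f g := if insub x is Some z then q z else 0.
have kerP x : g x = 0 -> x \in kernel g by move=> gx; rewrite inE gx.
have piE x (kx : x \in kernel g) : pi x = q (Sub x kx) by rewrite /pi insubT.
have kerE (z : cycles g) : g (val z) = 0 by have := valP z; rewrite inE => /eqP.
exists pi; split.
- move=> x y /kerP kx /kerP ky; have kxy : x - y \in kernel g by rewrite rpredB.
  rewrite !piE /q -raddfB; congr (\pi _)%qT.
  by apply: val_inj; rewrite raddfB /=.
- move=> x /kerP kx; rewrite piE /q.
  have -> : (\pi_(homology f g)%qT (Sub x kx : cycles g) = 0) <->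
            (Sub x kx : cycles g) \in boundaries f g.
    rewrite -[X in _ = X](raddf0 \pi_(homology f g)%qT) -{2}[Sub x kx]subr0.
    by rewrite Quotient.idealrBE; split=> [->//|/eqP].
  by rewrite inE; split=> [/asboolP|H]; last apply/asboolP; rewrite SubK.
- move=> h; exists (val (repr h : cycles g)); first exact: kerE.
  rewrite /pi valK /q; exact: reprK.
Qed.

(* phi need not be a chain map: it is only constrained on cycles. *)
Lemma homology_isomorphic (U V W U' V' W' : zmodType)
    (f : {additive U -> V}) (g : {additive V -> W})
    (f' : {additive U' -> V'}) (g' : {additive V' -> W'}) (phi : V -> V') :
  zmod_morphism phi ->
  (forall x, g x = 0 -> g' (phi x) = 0) ->
  (forall x, g x = 0 -> (exists b, f b = x) <-> (exists b, f' b = phi x)) ->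
  (forall y, g' y = 0 -> exists x, g x = 0 /\ exists b, f' b = y - phi x) ->
  isomorphic (homology f g) (homology f' g').
Proof.
move=> addphi phiZ phiB phiS.
have [pi [piB pi0 piS]] := homology_presentation f g.
have [pi' [piB' pi0' piS']] := homology_presentation f' g'.
(* A chosen representing cycle of each class. The choice need not be additive, so everything below
   goes through [piphi], by which the image class does not depend on it. *)
pose r h := s2val (cid2 (piS h)).
have gr h : g (r h) = 0 by rewrite /r; case: cid2.
have rK h : pi (r h) = h by rewrite /r; case: cid2.
have piphi x y : g x = 0 -> g y = 0 -> pi x = pi y ->
    pi' (phi x) = pi' (phi y).
  move=> gx gy /eqP; rewrite -subr_eq0 -piB // => /eqP.
  move/(pi0 _ _); rewrite raddfB gx gy subrr => /(_ erefl).
  move/phiB; rewrite raddfB gx gy subrr => /(_ erefl).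
  move/(pi0' _ _); rewrite addphi raddfB !phiZ // subrr => /(_ erefl).
  by rewrite piB' ?phiZ // => /eqP; rewrite subr_eq0 => /eqP.
apply: (@surj_inj_isomorphic _ _ (fun h => pi' (phi (r h)))).
- move=> x y; rewrite -piB' ?phiZ // -addphi; apply: piphi => //.
    by rewrite raddfB !gr subrr.
  by rewrite piB // !rK.
- move=> h /pi0' -/(_ (phiZ _ (gr h))) /phiB -/(_ (gr h)) /pi0.
  by rewrite rK; apply.
- move=> h; have [y gy <-] := piS' h; have [x [gx [b fb]]] := phiS y gy.
  exists (pi x); rewrite (piphi (r (pi x)) x) ?rK //.
  apply/eqP; rewrite eq_sym -subr_eq0 -piB' ?phiZ //; apply/eqP/pi0'.
    by rewrite raddfB gy phiZ // subrr.
  by exists b.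
Qed.

Lemma homology_trivial (U V W : zmodType) (f : {additive U -> V})
    (g : {additive V -> W}) :
  (forall x, g x = 0 -> exists b, f b = x) -> forall h : homology f g, h = 0.
Proof.
move=> gf h; have [pi [_ pi0 piS]] := homology_presentation f g.
by have [x gx <-] := piS h; apply/pi0 => //; exact: gf.
Qed.

(** * Complexes with a finite basis *)

Section BasedComplex.

Variable I : finType.
Implicit Types (D : I -> I -> int) (deg : I -> int) (A : {set I}).
Implicit Types (i : int) (c b : {ffun I -> int}).

Definition restrict A c : {ffun I -> int} :=
  [ffun s => if s \in A then c s else 0].

Definition differential D A c : {ffun I -> int} :=
  [ffun t => if t \in A then \sum_(s in A) c s * D s t else 0].

Definition degree_part deg i : {set I} := [set s | deg s == i].

Definition cycle_defect D deg A i c : {ffun I -> int} * {ffun I -> int} :=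
  (c - restrict (A :&: degree_part deg i) c, differential D A c).

Fact restrict_is_additive A : zmod_morphism (restrict A).
Proof. by move=> c b; apply/ffunP=> s; rewrite !ffunE; case: ifP. Qed.

HB.instance Definition _ A :=
  GRing.isZmodMorphism.Build {ffun I -> int} {ffun I -> int} (restrict A)
    (restrict_is_additive A).

Fact differential_is_additive D A : zmod_morphism (differential D A).
Proof.
move=> c b; apply/ffunP=> s; rewrite !ffunE; case: ifP => // _.
by rewrite -sumrB; apply: eq_bigr => t _; rewrite !ffunE mulrBl.
Qed.

HB.instance Definition _ D A :=
  GRing.isZmodMorphism.Build {ffun I -> int} {ffun I -> int} (differential D A)
    (differential_is_additive D A).

Fact cycle_defect_is_additive D deg A i :
  zmod_morphism (cycle_defect D deg A i).
Proof.
move=> c b; rewrite /cycle_defect !raddfB /=; congr pair.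
rewrite -[RHS]/(c - _ - (b - _)) opprD addrACA; congr (_ + (_ + _)).
Qed.

HB.instance Definition _ D deg A i :=
  GRing.isZmodMorphism.Build
    {ffun I -> int} ({ffun I -> int} * {ffun I -> int})%type
    (cycle_defect D deg A i) (cycle_defect_is_additive D deg A i).

(* Homology in degree i of the complex with basis A, where D s t is the
   coefficient of t in the differential of s. All chains on I are admitted in
   the middle group, and cycle_defect cuts out those supported on the basis
   elements of degree i, as well as the cycles. *)
Definition based_homology D deg A i : zmodType :=
  homology (differential D A) (cycle_defect D deg A i).

Definition homogeneous D deg := forall s t, D s t != 0 -> deg s = deg t + 1.

Lemma cycle_defectP D deg A i c :
  cycle_defect D deg A i c = 0 <->
  restrict (A :&: degree_part deg i) c = c /\ differential D A c = 0.
Proof.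
rewrite /cycle_defect; split=> [[/eqP]|[-> ->]]; last by rewrite subrr.
by rewrite subr_eq0 => /eqP.
Qed.

Lemma restrictP A c : (forall s, s \notin A -> c s = 0) <-> restrict A c = c.
Proof.
split=> [cA|<- s /negPf sA]; last by rewrite ffunE sA.
by apply/ffunP=> s; rewrite ffunE; case: ifPn => // /cA.
Qed.

Definition extend_by_zero (P : pred I) (c : {ffun {s | P s} -> int}) :
    {ffun I -> int} :=
  [ffun s => if insub s is Some z then c z else 0].

Lemma extend_by_zeroE (P : pred I) (c : {ffun {s | P s} -> int}) z :
  extend_by_zero c (val z) = c z.
Proof. by rewrite ffunE valK. Qed.

Lemma extend_by_zero_out (P : pred I) (c : {ffun {s | P s} -> int}) s :
  ~~ P s -> extend_by_zero c s = 0.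
Proof. by move=> nPs; rewrite ffunE insubN. Qed.

Lemma sum_sig (P : pred I) (F : I -> int) :
  \sum_(z : {s | P s}) F (val z) = \sum_(s | P s) F s.
Proof.
have [[s0 Ps0]|P0] := pselect (exists s, P s).
  rewrite [RHS](reindex_onto val (insubd (Sub s0 Ps0 : {s | P s}))) /=.
    by apply: eq_bigl => z; rewrite (valP z) valKd eqxx.
  by move=> s Ps; rewrite insubdK.
rewrite !big1 // => [s Ps|z _]; case: P0; first by exists s.
by exists (val z); exact: valP.
Qed.

Lemma sum_extend_by_zero (P : pred I) (c : {ffun {s | P s} -> int}) A
    (F : I -> int) : (forall s, P s -> s \in A) ->
  \sum_(s in A) extend_by_zero c s * F s = \sum_z c z * F (val z).
Proof.
move=> PA; under [RHS]eq_bigr do rewrite -extend_by_zeroE.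
rewrite (sum_sig P (fun s => extend_by_zero c s * F s)).
rewrite [LHS](bigID P) /= [X in _ + X]big1 ?addr0 => [|s /andP[_ nP]].
  by apply: eq_bigl => s; apply/andP/idP => [[]|Ps] //; split=> //; exact: PA.
by rewrite extend_by_zero_out // mul0r.
Qed.

(** Extension by zero turns chains on the subtype of one degree into chains on all of [I], which
    removes the degree from the types. Homogeneity makes the differential of an extended chain
    vanish outside the adjacent degree. *)
Lemma homology_based (P Q R : pred I)
    (f : {additive {ffun {s | P s} -> int} -> {ffun {s | Q s} -> int}})
    (g : {additive {ffun {s | Q s} -> int} -> {ffun {s | R s} -> int}})
    D deg A i :
  (forall x t, f x t = \sum_s x s * D (val s) (val t)) ->
  (forall x t, g x t = \sum_s x s * D (val s) (val t)) ->
  (forall s, P s = (s \in A) && (deg s == i + 1)) ->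
  (forall s, Q s = (s \in A) && (deg s == i)) ->
  (forall s, R s = (s \in A) && (deg s == i - 1)) ->
  homogeneous D deg ->
  isomorphic (homology f g) (based_homology D deg A i).
Proof.
move=> fE gE PE QE RE hD.
have PA s : P s -> s \in A by rewrite PE => /andP[].
have QA s : Q s -> s \in A by rewrite QE => /andP[].
have D0 s t : deg s <> deg t + 1 -> D s t = 0.
  by move=> h; have [//|/hD] := eqVneq (D s t) 0.
have cyc x : g x = 0 -> cycle_defect D deg A i (extend_by_zero x) = 0.
  move=> gx; apply/cycle_defectP; split.
    apply/restrictP => s; rewrite !inE -QE; exact: extend_by_zero_out.
  apply/ffunP=> t; rewrite !ffunE; case: ifP => // tA.
  rewrite (sum_extend_by_zero _ (D^~ t)) //.
  have [Rt|] := boolP (R t).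
    by have /ffunP/(_ (Sub t Rt)) := gx; rewrite gE ffunE.
  rewrite RE tA /= => /eqP nt; rewrite big1 // => s _.
  rewrite D0 ?mulr0 //; have := valP s; rewrite /= QE => /andP[_ /eqP ->].
  by move=> h; apply: nt; rewrite h addrK.
apply: (@homology_isomorphic _ _ _ _ _ _ _ _ _ _ (@extend_by_zero Q)) => //.
- move=> c b; apply/ffunP=> s; rewrite !ffunE.
  by case: insub => [z|]; rewrite ?ffunE ?subrr.
- move=> c gc; split=> [[b fb]|[b db]].
    exists (extend_by_zero b); apply/ffunP=> t; rewrite ffunE.
    case: ifPn => [tA|tA]; last first.
      by rewrite extend_by_zero_out // QE (negPf tA).
    rewrite (sum_extend_by_zero _ (D^~ t)) //.
    have [Qt|nQ] := boolP (Q t).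
      by rewrite (extend_by_zeroE c (Sub t Qt)) -fb fE.
    rewrite extend_by_zero_out // big1 // => s _.
    rewrite D0 ?mulr0 //; have := valP s; rewrite /= PE => /andP[_ /eqP ->].
    by move: nQ; rewrite QE tA /= => /eqP nt /addIr h; apply: nt.
  exists [ffun s => b (val s)]; apply/ffunP=> t; rewrite fE.
  rewrite -[RHS]extend_by_zeroE -db ffunE (QA _ (valP t)).
  under eq_bigr do rewrite ffunE.
  rewrite (sum_sig P (fun s => b s * D s (val t))).
  rewrite [RHS](bigID P) /= [X in _ = _ + X]big1 ?addr0 => [|s /andP[sA nP]].
    by apply: eq_bigl => s; apply/idP/andP => [Ps|[]] //; split=> //; exact: PA.
  rewrite D0 ?mulr0 // => h; move: nP; rewrite PE sA /= h.
  by have := valP t; rewrite /= QE => /andP[_ /eqP ->]; rewrite eqxx.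
- move=> y /cycle_defectP[/restrictP yQ dy].
  have yE : extend_by_zero [ffun s : {s | Q s} => y (val s)] = y.
    apply/ffunP=> s; have [Qs|nQ] := boolP (Q s).
      by rewrite (extend_by_zeroE _ (Sub s Qs)) ffunE.
    by rewrite extend_by_zero_out // yQ // !inE -QE.
  exists [ffun s => y (val s)]; split; last by exists 0; rewrite yE subrr raddf0.
  apply/ffunP=> t; rewrite gE ffunE.
  have tA : val t \in A by have := valP t; rewrite /= RE => /andP[].
  rewrite -(sum_extend_by_zero _ (D^~ (val t)) QA) yE.
  by have /ffunP/(_ (val t)) := dy; rewrite !ffunE tA.
Qed.

(** The square of the differential vanishes with intermediate elements taken in [A] only, so [A] may
    also be a difference of two simplicial complexes, as for relative chains. *)
Definition based_complex D A :=
  forall s u, s \in A -> u \in A -> \sum_(t in A) D s t * D t u = 0.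

(** Ungraded: cycles may mix degrees. This gives vanishing of the homology in every degree at
    once. *)
Definition acyclic D A :=
  forall c, restrict A c = c -> differential D A c = 0 ->
    exists b, differential D A b = c.

Lemma restrict_restrict A A' c :
  restrict A (restrict A' c) = restrict (A :&: A') c.
Proof. by apply/ffunP=> s; rewrite !ffunE inE; case: (s \in A). Qed.

Lemma restrict_id A c : restrict A (restrict A c) = restrict A c.
Proof. by rewrite restrict_restrict setIid. Qed.

Lemma restrictCA A A' c :
  restrict A (restrict A' c) = restrict A' (restrict A c).
Proof. by rewrite !restrict_restrict setIC. Qed.

Lemma restrict_differential D A c :
  restrict A (differential D A c) = differential D A c.
Proof. by apply/ffunP=> s; rewrite !ffunE; case: (s \in A). Qed.

Lemma differential_restrict D A c :
  differential D A (restrict A c) = differential D A c.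
Proof.
apply/ffunP=> t; rewrite !ffunE; case: ifP => // _.
by apply: eq_bigr => s sA; rewrite ffunE sA.
Qed.

(** Lets a primitive found by an ungraded argument be cut down to the degree in which it is
    wanted. *)
Lemma differential_degree D deg A i c : homogeneous D deg ->
  differential D A (restrict (degree_part deg (i + 1)) c) =
  restrict (degree_part deg i) (differential D A c).
Proof.
move=> hD; apply/ffunP=> t; rewrite !ffunE inE.
case: ifP => [tA|]; last by case: ifP.
case: eqP => [dt|dt].
  apply: eq_bigr => s sA; rewrite ffunE inE.
  have [->|/hD ->] := eqVneq (D s t) 0; first by rewrite !mulr0.
  by rewrite dt eqxx.
rewrite big1 // => s sA; rewrite ffunE inE.
have [->|/hD ->] := eqVneq (D s t) 0; first by rewrite mulr0.
by case: eqP => [/addIr|] //; rewrite mul0r.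
Qed.

Lemma differential_squared D A c : based_complex D A ->
  differential D A (differential D A c) = 0.
Proof.
move=> cD; apply/ffunP=> u; rewrite !ffunE; case: ifP => // uA.
under eq_bigr => t tA do rewrite ffunE tA mulr_suml.
rewrite exchange_big big1 // => s sA /=.
under eq_bigr do rewrite -mulrA.
by rewrite -mulr_sumr cD // mulr0.
Qed.

Lemma homogeneous_cycleP D deg A i c :
  cycle_defect D deg A i c = 0 <->
  [/\ restrict A c = c, restrict (degree_part deg i) c = c &
      differential D A c = 0].
Proof.
split=> [/cycle_defectP[cA dc]|[cA ci dc]]; last first.
  by apply/cycle_defectP; rewrite -restrict_restrict ci.
split=> //; first by rewrite -cA restrict_restrict setIA setIid.
by rewrite -{1}cA restrict_restrict setIC -setIA setIid.
Qed.

Lemma empty_degree_trivial D deg A i :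
  (forall s, s \in A -> deg s <> i) ->
  forall h : based_homology D deg A i, h = 0.
Proof.
move=> Ai; apply: homology_trivial => c /homogeneous_cycleP[/restrictP cA].
move=> /restrictP ci _; exists 0; rewrite raddf0; apply/ffunP=> s.
rewrite ffunE; have [/Ai di|/cA //] := boolP (s \in A).
by rewrite ci // inE; apply/eqP.
Qed.

Lemma acyclic_trivial D deg A i : acyclic D A ->
  forall h : based_homology D deg A i, h = 0.
Proof.
by move=> aA; apply: homology_trivial => c /homogeneous_cycleP[? _ ?]; exact: aA.
Qed.

(** * Short exact sequences: a subcomplex [A] of [B] with quotient [E] *)

Section Subcomplex.

Variables (D : I -> I -> int) (A E B : {set I}).
Hypothesis BE : B = A :|: E.
Hypothesis disjAE : [disjoint A & E].
Hypothesis D_AE : forall s t, s \in A -> t \in E -> D s t = 0.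
Hypothesis D_complex : based_complex D B.

Let p := restrict A.
Let q := restrict E.
Let dB := differential D B.

Let notAE s : s \in A -> s \in E = false.
Proof. by move=> sA; rewrite (disjointFr disjAE). Qed.

Let restrictB c : restrict B c = p c + q c.
Proof.
apply/ffunP=> s; rewrite !ffunE BE inE.
have [sA|_] := boolP (s \in A); first by rewrite notAE // addr0.
by case: ifP; rewrite add0r.
Qed.

Let differential_sub c : differential D A c = dB (p c).
Proof.
apply/ffunP=> t; rewrite !ffunE BE inE.
under [in RHS]eq_bigr do rewrite ffunE.
rewrite [in RHS](bigID (mem A)) /= [X in _ + X]big1 ?addr0; last first.
  by move=> s /andP[_ /negPf ->]; rewrite mul0r.
have AE : \sum_(s in A :|: E | s \in A) (if s \in A then c s else 0) * D s t =
          \sum_(s in A) c s * D s t.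
  apply: eq_big => s; first by rewrite inE andbC; case: (s \in A).
  by case/andP=> _ ->.
rewrite AE; have [//|tA] := boolP (t \in A); case: ifP => // tE.
by rewrite big1 // => s sA; rewrite D_AE // mulr0.
Qed.

Let differential_quot c : differential D E c = q (dB c).
Proof.
apply/ffunP=> t; rewrite !ffunE BE inE; case: ifP => // tE; rewrite orbT.
rewrite [RHS](bigID (mem A)) /= [X in _ = X + _]big1 ?add0r; last first.
  by move=> s /andP[_ sA]; rewrite D_AE // mulr0.
apply: eq_bigl => s; rewrite inE andbC.
case: (boolP (s \in A)) => sA; first by rewrite notAE.
by case: (s \in E).
Qed.

Let qB x y : q (x - y) = q x - q y. Proof. exact: raddfB. Qed.
Let dBD x y : dB (x + y) = dB x + dB y. Proof. exact: raddfD. Qed.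
Let dBB x y : dB (x - y) = dB x - dB y. Proof. exact: raddfB. Qed.
Let BB x y : restrict B (x - y) = restrict B x - restrict B y.
Proof. exact: raddfB. Qed.
Let q0 : q 0 = 0. Proof. exact: raddf0. Qed.
Let pp c : p (p c) = p c. Proof. exact: restrict_id. Qed.
Let qq c : q (q c) = q c. Proof. exact: restrict_id. Qed.

Let qp c : q (p c) = 0.
Proof.
apply/ffunP=> s; rewrite !ffunE; case: ifP => // sE.
by rewrite (disjointFl disjAE).
Qed.

Let pq c : p (q c) = 0. Proof. by rewrite -(qp c); exact: restrictCA. Qed.

Let restrictB_sub c : p c = c -> restrict B c = c.
Proof. by move=> cA; rewrite restrictB cA -[X in q X]cA qp addr0. Qed.

Let restrictB_quot c : q c = c -> restrict B c = c.
Proof. by move=> cE; rewrite restrictB cE -[X in p X]cE pq add0r. Qed.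

Let sub_restrictB c : restrict B c = c -> q c = 0 -> p c = c.
Proof. by move=> cB qc; rewrite -[RHS]cB restrictB qc addr0. Qed.

Let dBE c : dB c = dB (p c) + dB (q c).
Proof. by rewrite -dBD -restrictB; exact/esym/differential_restrict. Qed.

Let dB_dB c : dB (dB c) = 0. Proof. exact: differential_squared. Qed.

Let q_dB c : q (dB (q c)) = q (dB c).
Proof. by rewrite -!differential_quot; exact: differential_restrict. Qed.

Let B_dB c : restrict B (dB c) = dB c.
Proof. exact: restrict_differential. Qed.

Let acyclicA c : acyclic D A -> p c = c -> dB c = 0 -> exists b, dB (p b) = c.
Proof.
move=> aA pc dc; have [||b] := aA c => //; first by rewrite differential_sub pc.
by rewrite differential_sub => db; exists b.
Qed.

Let acyclicE c :
  acyclic D E -> q (dB c) = 0 -> exists b, q (dB b) = q c.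
Proof.
move=> aE dc; have [||b] := aE (q c); first exact: qq.
  by rewrite differential_quot q_dB.
by rewrite differential_quot => db; exists b.
Qed.

(** The [E]-part of a cycle is removed by subtracting a boundary; what is left is a cycle of [A],
    hence a boundary too. *)
Lemma acyclic_extension : acyclic D A -> acyclic D E -> acyclic D B.
Proof.
move=> aA aE c cB; rewrite -/(dB c) => dc.
have [|b qb] := acyclicE (c := c) aE; first by rewrite dc q0.
have [||a da] := acyclicA (c := c - dB b) aA.
- by apply: sub_restrictB; rewrite ?BB ?B_dB ?cB // qB qb subrr.
- by rewrite dBB dc dB_dB subrr.
by exists (b + p a); rewrite -/(dB _) dBD da addrC subrK.
Qed.

Variable deg : I -> int.
Hypothesis D_homogeneous : homogeneous D deg.

Let g i := restrict (degree_part deg i).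

Let gB i x y : g i (x - y) = g i x - g i y. Proof. exact: raddfB. Qed.
Let dBg i c : dB (g (i + 1) c) = g i (dB c).
Proof. exact: differential_degree. Qed.
Let pg i c : p (g i c) = g i (p c). Proof. exact: restrictCA. Qed.
Let qg i c : q (g i c) = g i (q c). Proof. exact: restrictCA. Qed.
Let gg i c : g i (g i c) = g i c. Proof. exact: restrict_id. Qed.

Let cycleB i c : cycle_defect D deg B i c = 0 <->
  [/\ restrict B c = c, g i c = c & dB c = 0].
Proof. exact: homogeneous_cycleP. Qed.

Let cycleA i c : cycle_defect D deg A i c = 0 <->
  [/\ p c = c, g i c = c & dB c = 0].
Proof.
split=> [/homogeneous_cycleP[cA ci]|[cA ci dc]].
  by rewrite differential_sub [p c]cA.
by apply/homogeneous_cycleP; split=> //; rewrite differential_sub cA.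
Qed.

Let cycleE i c : cycle_defect D deg E i c = 0 <->
  [/\ q c = c, g i c = c & q (dB c) = 0].
Proof. by rewrite -differential_quot; exact: homogeneous_cycleP. Qed.

(** The isomorphism is induced by the inclusion of [A] in [B]: chains of [B] are pushed into [A] by
    subtracting boundaries that cancel their [E]-parts. *)
Lemma based_homology_sub i : acyclic D E ->
  isomorphic (based_homology D deg A i) (based_homology D deg B i).
Proof.
move=> aE; apply: (@homology_isomorphic _ _ _ _ _ _ _ _ _ _ id) => //.
- move=> c /cycleA[cA ci dc]; apply/cycleB; split=> //; exact: restrictB_sub.
- move=> c /cycleA[cA ci dc]; split=> [[b]|[b]].
    by rewrite /= differential_sub => <-; exists (p b).
  rewrite /= -/(dB b) => db.
  have [|e de] := acyclicE (c := b) aE; first by rewrite db -cA qp.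
  (* Subtracting [dB e] does not change the boundary of [b] and removes its [E]-part. *)
  exists (b - dB e); rewrite /= differential_sub.
  have := dBE (b - dB e); rewrite [q _]qB de subrr [dB 0]raddf0 addr0 => <-.
  by rewrite dBB dB_dB subr0.
- move=> c /cycleB[cB ci dc].
  have [|e de] := acyclicE (c := c) aE; first by rewrite dc q0.
  exists (c - dB (g (i + 1) e)).
  split; last by exists (g (i + 1) e); rewrite opprB addrCA subrr addr0.
  apply/cycleA; split.
  + apply: sub_restrictB; first by rewrite BB B_dB cB.
    by rewrite qB dBg qg de -qg ci subrr.
  + by rewrite gB dBg gg ci.
  + by rewrite dBB dB_dB dc subrr.
Qed.

(** The isomorphism is induced by the projection [q] onto the quotient. *)
Lemma based_homology_quot i : acyclic D A ->
  isomorphic (based_homology D deg B i) (based_homology D deg E i).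
Proof.
move=> aA; apply: (@homology_isomorphic _ _ _ _ _ _ _ _ _ _ q) => //.
- move=> c /cycleB[cB ci dc]; apply/cycleE.
  by rewrite qq -qg ci q_dB dc q0.
- move=> c /cycleB[cB ci dc]; split=> [[b]|[b]].
    by rewrite /= -/(dB b) => db; exists b; rewrite /= differential_quot db.
  rewrite /= differential_quot => db.
  have [||a da] := acyclicA (c := c - dB b) aA.
  + by apply: sub_restrictB; rewrite ?BB ?B_dB ?cB // qB db subrr.
  + by rewrite dBB dB_dB dc subrr.
  by exists (b + p a); rewrite /= -/(dB _) dBD da addrC subrK.
(* A cycle [y] of [E] has its boundary in [A]. That boundary is a cycle of [A], so it bounds some
   chain of [A], and subtracting the degree [i] part of this chain lifts [y] to a cycle of [B]. *)
- move=> y /cycleE[yE yi dy].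
  have [||a da] := acyclicA (c := dB y) aA => //; first exact: sub_restrictB.
  have dga : dB (p (g i a)) = dB y.
    by rewrite pg -[in g i](subrK 1 i) dBg da -dBg subrK yi.
  exists (y - p (g i a)); split; last first.
    by exists 0; rewrite raddf0 qB qp subr0 yE subrr.
  apply/cycleB; split.
  + by rewrite BB restrictB_quot // restrictB_sub.
  + by rewrite gB -pg gg yi.
  + by rewrite dBB dga subrr.
Qed.

(** This is the connecting map of the long exact sequence. A class of [E] has a representative
    supported on [E], which is its own lift to [B], so the map is just [dB]. *)
Lemma based_homology_connecting i : acyclic D B ->
  isomorphic (based_homology D deg E (i + 1)) (based_homology D deg A i).
Proof.
move=> aB; apply: (@homology_isomorphic _ _ _ _ _ _ _ _ _ _ dB) => //.
- move=> c /cycleE[cE ci dc]; apply/cycleA.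
  by rewrite dB_dB -dBg ci; split=> //; exact: sub_restrictB.
- move=> c /cycleE[cE ci dc]; split=> [[b]|[b]].
    (* Here [c] is [dB b] minus the [A]-part of [dB b], so its boundary is that of minus this
       [A]-part. *)
    rewrite /= differential_quot => db; exists (- dB b).
    rewrite /= differential_sub -db.
    have -> : q (dB b) = dB b - p (dB b).
      by rewrite -[X in X - _]B_dB restrictB addrC addKr.
    by rewrite dBB dB_dB sub0r /p /dB !raddfN.
  rewrite /= differential_sub => db.
  have [||a] := aB (c - p b).
  + by rewrite BB restrictB_quot // restrictB_sub.
  + by rewrite /= -/(dB _) dBB db subrr.
  rewrite /= -/(dB a) => da; exists a; rewrite /= differential_quot da.
  by rewrite qB qp subr0 cE.
- move=> y /cycleA[yA yi dy].
  have [||b] := aB y; [exact: restrictB_sub| exact: dy |].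
  rewrite /= -/(dB b) => db.
  have dgb : dB (g (i + 1) b) = y by rewrite dBg db yi.
  have dx : dB (q (g (i + 1) b)) = y - dB (p (g (i + 1) b)).
    by rewrite -{1}dgb [dB (g _ _)]dBE addrAC subrr add0r.
  exists (q (g (i + 1) b)); split.
    apply/cycleE; rewrite qq -qg gg; split=> //.
    by rewrite q_dB dgb -yA qp.
  by exists (g (i + 1) b); rewrite /= differential_sub dx opprB addrCA subrr addr0.
Qed.

End Subcomplex.

(** The coboundary. It raises degrees, so it is paired with the negated degree: cohomology in degree
    [i] is based homology of the transpose in degree [- i]. *)
Definition transpose D s t := D t s.

Lemma based_complex_transpose D A :
  based_complex D A -> based_complex (transpose D) A.
Proof.
move=> cD s u sA uA; rewrite -[RHS](cD u s) //.
by apply: eq_bigr => t _; rewrite mulrC.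
Qed.

Lemma homogeneous_transpose D deg :
  homogeneous D deg -> homogeneous (transpose D) (fun s => - deg s).
Proof. by move=> hD s t /hD ->; rewrite opprD subrK. Qed.

Lemma acyclic_set0 D : acyclic D set0.
Proof.
move=> c c0 _; exists 0; rewrite raddf0 -c0; apply/ffunP=> s.
by rewrite !ffunE inE.
Qed.

(** The elementary acyclic complex: two generators whose coefficient is a sign, hence its own
    inverse. *)
Lemma acyclic_pair D (x y : I) : x != y ->
  D x y ^+ 2 = 1 -> D y x = 0 -> D x x = 0 -> D y y = 0 ->
  acyclic D [set x; y].
Proof.
move=> xy Dxy Dyx Dxx Dyy c /restrictP cA dc.
have sumE b t : \sum_(s in [set x; y]) b s * D s t = b x * D x t + b y * D y t.
  by rewrite big_setU1 ?big_set1 // inE.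
have cx : c x = 0.
  have /ffunP/(_ y) := dc; rewrite !ffunE sumE !inE eqxx orbT Dyy mulr0 addr0.
  by move/(congr1 ( *%R^~ (D x y))); rewrite mul0r -mulrA -expr2 Dxy mulr1.
exists [ffun s => if s == x then c y * D x y else 0]; apply/ffunP=> t.
rewrite ffunE sumE !ffunE eqxx eq_sym (negPf xy) mul0r addr0.
case: ifPn => [|/cA //]; rewrite !inE => /orP[] /eqP ->.
  by rewrite Dxx mulr0.
by rewrite -mulrA -expr2 Dxy mulr1.
Qed.

End BasedComplex.

(** Rescaling each basis element [s] by [eta s] turns the relabelling into a chain map. Comparing
    degrees at [i] and [i'] alone suffices, because boundaries of chains of all degrees are divided
    out. *)
Lemma based_homology_relabel (I I' : finType) (D : I -> I -> int)
    (D' : I' -> I' -> int) (deg : I -> int) (deg' : I' -> int)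
    (A : {set I}) (A' : {set I'}) (i i' : int)
    (j : I -> I') (k : I' -> I) (eta : I -> int) :
  {in A, forall s, j s \in A'} -> {in A', forall s, k s \in A} ->
  {in A, cancel j k} -> {in A', cancel k j} ->
  (forall s, eta s ^+ 2 = 1) ->
  {in A &, forall s t, D' (j s) (j t) = eta s * eta t * D s t} ->
  {in A, forall s, (deg' (j s) == i') = (deg s == i)} ->
  isomorphic (based_homology D deg A i) (based_homology D' deg' A' i').
Proof.
move=> jA kA jK kK eta2 DE degE.
pose phi (c : {ffun I -> int}) : {ffun I' -> int} :=
  [ffun s => if s \in A' then eta (k s) * c (k s) else 0].
pose psi (c : {ffun I' -> int}) : {ffun I -> int} :=
  [ffun s => if s \in A then eta s * c (j s) else 0].
have phiB : zmod_morphism phi.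
  move=> c b; apply/ffunP=> s; rewrite !ffunE; case: ifP => // _.
  by rewrite mulrBr.
have phiK y : restrict A' y = y -> phi (psi y) = y.
  move=> /restrictP yA; apply/ffunP=> s; rewrite !ffunE; case: ifPn => sA.
    by rewrite kA // kK // mulrA -expr2 eta2 mul1r.
  by rewrite yA.
have psiK c : restrict A c = c -> psi (phi c) = c.
  move=> /restrictP cA; apply/ffunP=> s; rewrite !ffunE; case: ifPn => sA.
    by rewrite jA // jK // mulrA -expr2 eta2 mul1r.
  by rewrite cA.
have psiA c : restrict A (psi c) = psi c.
  by apply/restrictP=> s /negPf sA; rewrite ffunE sA.
have phiA c : restrict A' (phi c) = phi c.
  by apply/restrictP=> s /negPf sA; rewrite ffunE sA.
have phid c : differential D' A' (phi c) = phi (differential D A c).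
  apply/ffunP=> t; rewrite !ffunE; case: ifP => // tA; rewrite kA //.
  rewrite mulr_sumr (reindex_onto j k) /=; last by move=> s /kK.
  rewrite (eq_bigl (mem A)) => [|s /=]; last first.
    apply/andP/idP => [[sA /eqP <-]|sA]; first exact: kA.
    by rewrite jA // jK // eqxx.
  apply: eq_bigr => s sA; rewrite ffunE jA // jK // -{1}[t]kK // DE ?kA //.
  have -> : eta s * c s * (eta s * eta (k t) * D s (k t)) =
            eta s ^+ 2 * (eta (k t) * (c s * D s (k t))) by ring.
  by rewrite eta2 mul1r.
apply: (@homology_isomorphic _ _ _ _ _ _ _ _ _ _ phi) => //.
- move=> c /homogeneous_cycleP[/restrictP cA /restrictP ci dc].
  apply/homogeneous_cycleP; split=> //; last first.
    by rewrite phid dc -[0]subr0 phiB subrr.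
  apply/restrictP => s; rewrite inE ffunE; case: ifP => // sA.
  by rewrite -{1}[s]kK // degE ?kA // => si; rewrite ci ?mulr0 // inE.
- move=> c /homogeneous_cycleP[cA ci dc]; split=> [[b /= db]|[b /= db]].
    by exists (phi b); rewrite /= phid db.
  exists (psi (restrict A' b)); rewrite /= -[LHS]psiK ?restrict_differential //.
  by rewrite -phid phiK ?restrict_id // differential_restrict db psiK.
- move=> y /homogeneous_cycleP[yA /restrictP yi dy]; exists (psi y); split.
    apply/homogeneous_cycleP; split=> //.
      apply/restrictP=> s; rewrite inE ffunE; case: ifP => // sA si.
      by rewrite yi ?mulr0 // inE degE.
    rewrite -[LHS]psiK ?restrict_differential // -phid phiK // dy.
    by apply/ffunP=> s; rewrite !ffunE mulr0; case: ifP.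
  by exists 0; rewrite raddf0 phiK // subrr.
Qed.

(** * Matchings of simplices *)

Section RankedIncidence.

Variables (T : finType) (r : T -> nat).
Hypothesis r_inj : injective r.
Implicit Types (s t u : {set T}) (x y : T).

Definition position_sign (s : {set T}) (x : T) : int :=
  (-1) ^+ #|[set y in s | (r y < r x)%N]|.

(* The orientation of simplices is induced by r: this is incidence when r is
   enum_rank, and other ranks make vertex inclusions orientation preserving. *)
Definition ranked_incidence (s t : {set T}) : int :=
  \sum_(x in s | t == s :\ x) position_sign s x.

Definition simplex_degree (s : {set T}) : int := #|s|%:Z - 1.

Lemma ranked_incidence_neq0 s t : ranked_incidence s t != 0 ->
  exists2 x, x \in s & t = s :\ x.
Proof.
move=> st; have [x /andP[xs /eqP ->]|no] := pickP [pred x in s | t == s :\ x].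
  by exists x.
by move: st; rewrite /ranked_incidence big_pred0 ?eqxx.
Qed.

Lemma ranked_incidence_facet s x : x \in s ->
  ranked_incidence s (s :\ x) = position_sign s x.
Proof.
move=> xs; rewrite /ranked_incidence (big_pred1 x) // => y.
apply/andP/eqP => [[ys /eqP/setP/(_ y)]|-> //]; rewrite !inE ys eqxx andbT.
by move/negbFE/eqP.
Qed.

Lemma ranked_incidence_homogeneous : homogeneous ranked_incidence simplex_degree.
Proof.
move=> s t /ranked_incidence_neq0[x xs ->].
by rewrite /simplex_degree (cardsD1 x s) xs; lia.
Qed.

Lemma position_sign_sqr s x : position_sign s x ^+ 2 = 1.
Proof. exact: sqrr_sign. Qed.

Lemma position_signD1 s x y : x \in s ->
  position_sign s y = position_sign (s :\ x) y * (-1) ^+ (r x < r y)%N.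
Proof.
move=> xs; rewrite /position_sign -exprD (cardsD1 x) !inE xs /= addnC.
congr (_ ^+ (_ + _)); apply: eq_card => z; rewrite !inE; by rewrite andbA.
Qed.

Lemma ranked_incidence_sum s (F : {set T} -> int) :
  \sum_t ranked_incidence s t * F t =
  \sum_(x in s) position_sign s x * F (s :\ x).
Proof.
under eq_bigr do rewrite mulr_suml.
rewrite (exchange_big_dep (mem s)) /= => [|t x _ /andP[]//].
apply: eq_bigr => x xs; rewrite (big_pred1 (s :\ x)) // => t.
by rewrite xs.
Qed.

(** Two vertices can be removed in either order. By [position_signD1] the two orders carry opposite
    signs, as exactly one of the vertices precedes the other, so the sum equals its own negative. *)
Lemma ranked_incidence_squared s u :
  \sum_t ranked_incidence s t * ranked_incidence t u = 0.
Proof.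
rewrite ranked_incidence_sum.
pose P x y := [&& x \in s, y \in s, x != y & u == s :\ x :\ y].
pose G x y := position_sign s x * position_sign (s :\ x) y.
have -> : \sum_(x in s) position_sign s x * ranked_incidence (s :\ x) u =
          \sum_x \sum_(y | P x y) G x y.
  rewrite [RHS](bigID (mem s)) /= [X in _ = _ + X]big1 ?addr0 => [|x xs].
    apply: eq_bigr => x xs; rewrite mulr_sumr; apply: eq_bigl => y.
    by rewrite /P xs !inE [x == y]eq_sym; case: (y \in s); rewrite ?andbT ?andbF.
  by rewrite big_pred0 // => y; rewrite /P (negPf xs).
suff S : \sum_x \sum_(y | P x y) G x y = - \sum_x \sum_(y | P x y) G x y.
  by apply/eqP; move/eqP: S; rewrite -addr_eq0 -mulr2n mulrn_eq0.
rewrite [LHS](exchange_big_dep predT) //= -sumrN; apply: eq_bigr => y _.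
rewrite -sumrN; apply: eq_big => x.
  by rewrite /P !setDDl [y |: _]setUC andbCA [x == y]eq_sym.
case/and4P=> xs ys xy _.
have Gs z w : z \in s -> w \in s ->
    G z w = position_sign s z * position_sign s w * (-1) ^+ (r z < r w)%N.
  by move=> zs ws; rewrite (position_signD1 w zs) /G -!mulrA -expr2 sqrr_sign mulr1.
rewrite !Gs // [position_sign s y * _]mulrC -mulrN; congr (_ * _).
have : r x != r y by apply: contra xy => /eqP/r_inj->.
by case: ltngtP.
Qed.

(** For a convex family, every simplex between two members is a member, so the restricted sum misses
    no non-zero term. *)
Lemma based_complex_incidence (A : {set {set T}}) :
  (forall s t u, s \in A -> u \in A -> u \subset t -> t \subset s -> t \in A) ->
  based_complex ranked_incidence A.
Proof.
move=> convexA s u sA uA; rewrite -[RHS](ranked_incidence_squared s u).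
rewrite [RHS](bigID (mem A)) /= [X in _ = _ + X]big1 ?addr0 // => t tA.
have [->|/ranked_incidence_neq0[x xs ts]] := eqVneq (ranked_incidence s t) 0.
  by rewrite mul0r.
have [->|/ranked_incidence_neq0[y yt ut]] := eqVneq (ranked_incidence t u) 0.
  by rewrite mulr0.
by case/negP: tA; apply: convexA sA uA _ _; [rewrite ut | rewrite ts]; exact: subD1set.
Qed.

Definition toggle (x : T) (s : {set T}) : {set T} :=
  if x \in s then s :\ x else x |: s.

Lemma toggleK x : involutive (toggle x).
Proof.
move=> s; rewrite /toggle; case: (boolP (x \in s)) => xs.
  by rewrite !inE eqxx setD1K.
by rewrite setU11 setU1K.
Qed.

(** * Acyclic matchings *)

Section Matching.

Variables (weight : T -> nat) (v : {set T} -> T).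
Hypothesis weight_gt0 : forall x, (0 < weight x)%N.

(* s is paired with toggle (v s) s. By the last condition, the pair of a simplex
   of maximal total weight can be split off from E, so that the matching is
   acyclic in the sense of discrete Morse theory. *)
Definition matched (E : {set {set T}}) :=
  [/\ based_complex ranked_incidence E,
      {in E, forall s, toggle (v s) s \in E},
      {in E, forall s, v (toggle (v s) s) = v s} &
      forall s y, s \in E -> v s \in s -> y \notin s :\ v s ->
        y |: (s :\ v s) \in E -> v (y |: (s :\ v s)) != v s ->
        (weight (v s) < weight y)%N].

Let w (s : {set T}) := (\sum_(x in s) weight x)%N.

Let wU1 x s : x \notin s -> w (x |: s) = (weight x + w s)%N.
Proof. exact: big_setU1. Qed.

Let wD1 x s : x \in s -> w s = (weight x + w (s :\ x))%N.
Proof. exact: big_setD1. Qed.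

(** If [v s] were not in [s], toggling would give a heavier simplex. Let another [t] have the facet
    [s :\ v s]. If [v t = v s], toggling adds [v s] to [t] and exceeds [s]; otherwise the last
    condition of [matched] makes [t] itself heavier than [s]. *)
Lemma matched_top E s : matched E -> s \in E ->
  (forall t, t \in E -> (w t <= w s)%N) ->
  [/\ v s \in s, s :\ v s \in E,
      forall t, t \in E -> ranked_incidence t s = 0 &
      forall t, t \in E -> t != s -> ranked_incidence t (s :\ v s) = 0].
Proof.
case=> _ togE togv wv sE smax.
have vs : v s \in s.
  apply: contraT => nvs; have := smax _ (togE s sE).
  by rewrite /toggle (negPf nvs) wU1 // -{2}[w s]add0n leq_add2r leqNgt weight_gt0.
have bE : s :\ v s \in E by have := togE s sE; rewrite /toggle vs.
split=> // t tE.
  have [//|/ranked_incidence_neq0[x xt ts]] := eqVneq (ranked_incidence t s) 0.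
  have := smax t tE; rewrite (wD1 xt) -ts -{2}[w s]add0n leq_add2r leqNgt.
  by rewrite weight_gt0.
move=> ts; have [//|] := eqVneq (ranked_incidence t (s :\ v s)) 0.
case/ranked_incidence_neq0=> x xt bt.
have te : t = x |: (s :\ v s) by rewrite bt setD1K.
have xb : x \notin s :\ v s by rewrite bt !inE eqxx.
have xv : x != v s by apply: contra ts => /eqP xv; rewrite te xv setD1K.
have xs : x \notin s by move: xb; rewrite !inE xv.
have [vt|vt] := eqVneq (v t) (v s); last first.
  have := wv s x sE vs xb; rewrite -te => /(_ tE vt).
  have := smax t tE; rewrite te wU1 // (wD1 vs) leq_add2r leqNgt => /negP nlt.
  by move/nlt.
have := smax _ (togE t tE); rewrite vt /toggle te !inE eqxx /= orbF.
rewrite eq_sym (negPf xv) setUCA setD1K // wU1 // -{2}[w s]add0n leq_add2r.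
by rewrite leqNgt weight_gt0.
Qed.

(** Induction on the size of [E]. By [matched_top], the pair of a heaviest simplex is an acyclic
    quotient of [E], and the rest [E'] is a subcomplex that is still matched. *)
Lemma matched_acyclic E : matched E ->
  acyclic ranked_incidence E /\ acyclic (transpose ranked_incidence) E.
Proof.
have [n] := ubnP #|E|; elim: n E => // n IH E ltn mE.
have [->|/set0Pn[s0 s0E]] := eqVneq E set0; first by split; exact: acyclic_set0.
case: (arg_maxnP w s0E) => s sE' smax; have sE : s \in E := sE'.
have [vs bE is0 ib0] := matched_top mE sE smax.
have [cE togE togv wv] := mE.
set b := s :\ v s in bE ib0.
have sb : s != b by apply/eqP=> /setP/(_ (v s)); rewrite !inE eqxx vs.
pose E' := E :\: [set s; b].
have sbE : [set s; b] \subset E by rewrite subUset !sub1set sE.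
have EE : E = E' :|: [set s; b] 
  by rewrite -{1}[E](setID _ [set s; b]) (setIidPr sbE) setUC.
have dE : [disjoint E' & [set s; b]] 
  by rewrite disjoints_subset /E' setDE subsetIr.
have E'E t : t \in E' -> [/\ t \in E, t != s & t != b].
  by rewrite !inE negb_or => /andP[/andP[]].
have i0 t u : t \in E' -> u \in [set s; b] -> ranked_incidence t u = 0.
  by case/E'E=> tE ts _; rewrite !inE => /orP[] /eqP->; [exact: is0 | exact: ib0].
have tgs : toggle (v s) s = b by rewrite /toggle vs.
have vb : v b = v s by rewrite -tgs togv.
have tgb : toggle (v s) b = s by rewrite -tgs toggleK.
have mE' : matched E'.
  split.
  (* Nothing in [E'] has [s] or [b] in its boundary, so the sum over [E] already runs over [E']
     only. *)
  - move=> t u tE' uE'; have [tE _ _] := E'E t tE'; have [uE _ _] := E'E u uE'.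
    rewrite -[RHS](cE t u) // [in RHS]EE [RHS](bigID (mem E')) /=.
    rewrite [X in _ = _ + X]big1 ?addr0 => [|x]; last first.
      rewrite in_setU => /andP[/orP[->//|xsb] _]; by rewrite i0 ?mul0r.
    by apply: eq_bigl => x; rewrite in_setU; case: (x \in E'); rewrite ?andbF.
  - move=> t /E'E[tE ts tb]; rewrite in_setD togE // andbT !inE negb_or.
    apply/andP; split; apply/eqP => tt.
      by case/eqP: tb; rewrite -tgs -tt togv // toggleK.
    by case/eqP: ts; rewrite -tgb -vb -tt togv // toggleK.
  - by move=> t /E'E[tE _ _]; exact: togv.
  - by move=> t y /E'E[tE _ _] vt yt /E'E[ytE _ _]; exact: wv.
have [|aE' aE't] := IH E' _ mE'.
  rewrite -ltnS; apply: leq_trans ltn; rewrite ltnS; apply: proper_card.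
  by apply/properP; split; [exact: subsetDl | exists s; rewrite ?inE ?eqxx].
have isb : ranked_incidence s b ^+ 2 = 1.
  by rewrite ranked_incidence_facet // position_sign_sqr.
have [iss ibs ibb] : [/\ ranked_incidence s s = 0, ranked_incidence b s = 0 &
    ranked_incidence b b = 0].
  by split; [exact: is0 | exact: is0 | apply: ib0; rewrite // eq_sym].
split.
  apply: (acyclic_extension EE dE i0 cE aE').
  exact: acyclic_pair.
(* Transposing exchanges the roles: the pair is now the subcomplex and [E'] the quotient. *)
apply: (@acyclic_extension _ _ [set s; b] E').
- by rewrite setUC.
- by rewrite disjoint_sym.
- by move=> t u tsb uE'; exact: i0.
- exact: based_complex_transpose.
- by rewrite setUC; apply: acyclic_pair; rewrite // eq_sym.
- exact: aE't.
Qed.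

(** For chains, [L'] is a subcomplex of [L] with acyclic quotient. For cochains, it is the quotient
    of [L] by the acyclic subcomplex spanned by the remaining simplices. *)
Lemma matched_isomorphic (L L' : {set {set T}}) i :
  (forall s t, s \in L -> t \subset s -> t \in L) ->
  (forall s t, s \in L' -> t \subset s -> t \in L') ->
  L' \subset L -> matched (L :\: L') ->
  isomorphic (based_homology ranked_incidence simplex_degree L' i)
             (based_homology ranked_incidence simplex_degree L i) /\
  isomorphic (based_homology (transpose ranked_incidence)
                (fun s => - simplex_degree s) L' i)
             (based_homology (transpose ranked_incidence)
                (fun s => - simplex_degree s) L i).
Proof.
move=> downL downL' sL /matched_acyclic[aE aEt].
have cL : based_complex ranked_incidence L.
  by apply: based_complex_incidence => s t u sinL _ _; exact: downL.
have EL : L = L' :|: (L :\: L') by rewrite -{1}(setID L L') (setIidPr sL).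
have dL : [disjoint L' & L :\: L'].
  by rewrite disjoint_sym disjoints_subset setDE subsetIr.
have i0 s t : s \in L' -> t \in L :\: L' -> ranked_incidence s t = 0.
  move=> sL'; rewrite inE => /andP[tL' _].
  have [//|/ranked_incidence_neq0[x _ ts]] := eqVneq (ranked_incidence s t) 0.
  by case/negP: tL'; apply: downL' sL' _; rewrite ts subD1set.
split; first exact: (based_homology_sub EL dL i0 cL ranked_incidence_homogeneous).
apply: isomorphic_sym.
apply: (@based_homology_quot _ _ (L :\: L') L') => //.
- by rewrite setUC.
- by rewrite disjoint_sym.
- by move=> s t sE tL'; exact: i0.
- exact: based_complex_transpose.
- exact/homogeneous_transpose/ranked_incidence_homogeneous.
Qed.

End Matching.

End RankedIncidence.

(** * The cylinder of a complex and a poset *)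

Lemma ranked_incidence_imset (T T' : finType) (r : T -> nat) (r' : T' -> nat)
    (f : T -> T') (s t : {set T}) :
  injective f -> (forall x y, (r' (f x) < r' (f y))%N = (r x < r y)%N) ->
  ranked_incidence r' (f @: s) (f @: t) = ranked_incidence r s t.
Proof.
move=> f_inj rf; rewrite /ranked_incidence.
have fD1 x : f @: s :\ f x = f @: (s :\ x).
  apply/setP=> y; rewrite !inE; apply/andP/imsetP => [[yx /imsetP[z zs yz]]|].
    by exists z; rewrite // !inE zs andbT; apply: contra yx => /eqP <-; rewrite yz.
  case=> z; rewrite !inE => /andP[zx zs] ->.
  by rewrite (inj_eq f_inj) zx imset_f.
rewrite big_mkcondr big_imset /=; last by move=> x y _ _; exact: f_inj.
rewrite [RHS]big_mkcondr; apply: eq_bigr => x xs.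
rewrite fD1 (inj_eq (imset_inj f_inj)) /position_sign.
case: ifP => // _; congr (_ ^+ _).
rewrite -[RHS](card_imset _ f_inj); apply: eq_card => y; rewrite !inE.
apply/andP/imsetP => [[/imsetP[z zs ->]]|[z]].
  by rewrite rf => zx; exists z; rewrite // inE zs.
by rewrite inE => /andP[zs zx] ->; rewrite imset_f // rf.
Qed.

Lemma based_homology_imset (T T' : finType) (r : T -> nat) (r' : T' -> nat)
    (f : T -> T') (K : {set {set T}}) (L : {set {set T'}}) (i : int) :
  injective f -> (forall x y, (r' (f x) < r' (f y))%N = (r x < r y)%N) ->
  {in K, forall s : {set T}, f @: s \in L} ->
  {in L, forall s : {set T'}, f @^-1: s \in K} ->
  {in L, forall s : {set T'}, f @: (f @^-1: s) = s} ->
  isomorphic (based_homology (ranked_incidence r) (@simplex_degree T) K i)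
             (based_homology (ranked_incidence r') (@simplex_degree T') L i) /\
  isomorphic (based_homology (transpose (ranked_incidence r))
                (fun s => - @simplex_degree T s) K i)
             (based_homology (transpose (ranked_incidence r'))
                (fun s => - @simplex_degree T' s) L i).
Proof.
move=> f_inj rf fK fL preK.
have fKc : {in K, cancel (fun s : {set T} => f @: s)
                         (fun s : {set T'} => f @^-1: s)}.
  by move=> s _; apply/setP=> x; rewrite inE mem_imset.
split; apply: (@based_homology_relabel _ _ _ _ _ _ _ _ _ _
    (fun s : {set T} => f @: s) (fun s : {set T'} => f @^-1: s) (fun=> 1)) => //.
- by move=> s t _ _; rewrite !mul1r; exact: ranked_incidence_imset.
- by move=> s _; rewrite /simplex_degree card_imset.
- by move=> s t _ _; rewrite !mul1r; exact: ranked_incidence_imset.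
- by move=> s _; rewrite /simplex_degree card_imset.
Qed.

(** * Reduced homology and cohomology as based homology *)

Notation enum_incidence T := (ranked_incidence (fun x : T => enum_rank x : nat)).

Lemma red_homology_based (T : finType) (K : {set {set T}}) (i : int) :
  isomorphic (red_homology K i)
    (based_homology (enum_incidence T) (@simplex_degree T) K i).
Proof.
apply: homology_based; last exact: ranked_incidence_homogeneous.
- by move=> c t; rewrite ffunE.
- by move=> c t; rewrite ffunE.
- by move=> s; rewrite /simplex_degree subr_eq.
- by move=> s; rewrite /simplex_degree subr_eq.
- by move=> s; rewrite /simplex_degree subr_eq.
Qed.

Lemma red_cohomology_based (T : finType) (K : {set {set T}}) (i : int) :
  isomorphic (red_cohomology K i)
    (based_homology (transpose (enum_incidence T))
       (fun s => - @simplex_degree T s) K (- i)).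
Proof.
apply: homology_based;
  last exact/homogeneous_transpose/ranked_incidence_homogeneous.
- by move=> c t; rewrite ffunE.
- by move=> c t; rewrite ffunE.
- by move=> s; rewrite /simplex_degree; congr (_ && _); lia.
- by move=> s; rewrite /simplex_degree; congr (_ && _); lia.
- by move=> s; rewrite /simplex_degree; congr (_ && _); lia.
Qed.

Section Cylinder.

Variables (d : Order.disp_t) (X : finPOrderType d) (V : finType).
Variables (K : {set {set V}}) (R : V -> X -> bool).
Hypothesis K_down : forall s t : {set V}, s \in K -> t \subset s -> t \in K.
Hypothesis K0 : set0 \in K.
Hypothesis R_up : forall v x y, R v x -> (x <= y)%O -> R v y.
Hypothesis R_total : forall x, exists v, R v x.
Hypothesis R_simplex : forall (s : {set V}) x,
  (forall v, v \in s -> R v x) -> s \in K.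
Hypothesis R_sup : forall s : {set V}, s \in K -> s != set0 ->
  exists2 x, forall v, v \in s -> R v x &
    forall y, (forall v, v \in s -> R v y) -> (x <= y)%O.

Let Y : finType := (V + X)%type.

(** Vertices of [V] come before elements of [X], and each part keeps its enumeration order, so both
    inclusions into [Y] preserve orientations. *)
Let r (y : Y) : nat :=
  match y with inl v => enum_rank v | inr x => (#|V| + enum_rank x)%N end.

Let r_inj : injective r.
Proof.
case=> [v|x] [w|y] /=.
- by move/val_inj/enum_rank_inj->.
- by move=> e; have := ltn_ord (enum_rank v); rewrite e ltnNge leq_addr.
- by move=> e; have := ltn_ord (enum_rank w); rewrite -e ltnNge leq_addr.
- by move/addnI/val_inj/enum_rank_inj->.
Qed.

Let vpart (s : {set Y}) : {set V} := inl @^-1: s.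
Let xpart (s : {set Y}) : {set X} := inr @^-1: s.

Definition cylinder : {set {set Y}} :=
  [set s | [&& vpart s \in K, xpart s \in order_complex X &
     [forall v in vpart s, forall x in xpart s, R v x]]].

Let cylinderP s : reflect [/\ vpart s \in K,
    forall x y, inr x \in s -> inr y \in s -> (x >=< y)%O &
    forall v x, inl v \in s -> inr x \in s -> R v x] (s \in cylinder).
Proof.
rewrite inE; apply: (iffP and3P) => [] [sK].
  rewrite inE => /forall_inP sX /forall_inP sR; split=> // [x y xs ys|v x vs xs].
    by have := sX x; rewrite inE => /(_ xs)/forall_inP/(_ y); rewrite inE; apply.
  by have := sR v; rewrite inE => /(_ vs)/forall_inP/(_ x); rewrite inE; apply.
move=> sX sR; split=> //.
  rewrite inE; apply/forall_inP=> x; rewrite inE => xs.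
  by apply/forall_inP=> y; rewrite inE; exact: sX.
apply/forall_inP=> v; rewrite inE => vs.
by apply/forall_inP=> x; rewrite inE; exact: sR.
Qed.

Let cylinder_down (s t : {set Y}) : s \in cylinder -> t \subset s -> t \in cylinder.
Proof.
move=> /cylinderP[sK sX sR] /subsetP ts; apply/cylinderP; split.
- by apply: K_down sK _; apply/subsetP=> v; rewrite !inE; exact: ts.
- by move=> x y /ts xs /ts; exact: sX.
- by move=> v x /ts vs /ts; exact: sR.
Qed.

(** [bottom] is the copy of [K] in the cylinder, and [top] that of the order complex of [X]. *)
Let bottom : {set {set Y}} := [set s in cylinder | xpart s == set0].
Let top : {set {set Y}} := [set s in cylinder | vpart s == set0].

Let bottomP s : reflect (s \in cylinder /\ forall x, inr x \notin s)
  (s \in bottom).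
Proof.
apply: (iffP setIdP) => [] [sC].
  by move=> /eqP/setP sx; split=> // x; have := sx x; rewrite !inE => ->.
by move=> sx; split=> //; apply/eqP/setP=> x; rewrite !inE (negPf (sx x)).
Qed.

Let topP s : reflect (s \in cylinder /\ forall v, inl v \notin s) (s \in top).
Proof.
apply: (iffP setIdP) => [] [sC].
  by move=> /eqP/setP sv; split=> // v; have := sv v; rewrite !inE => ->.
by move=> sv; split=> //; apply/eqP/setP=> v; rewrite !inE (negPf (sv v)).
Qed.

Let chain_min (s : {set Y}) x : s \in cylinder -> inr x \in s ->
  exists2 x0, inr x0 \in s & forall y, inr y \in s -> (x0 <= y)%O.
Proof.
(* The number [h y] of elements below [y] is strictly increasing in [y], so minimizing it over a
   chain yields the least element. *)
move=> /cylinderP[_ sX _] xs; pose h (y : X) := #|[set z : X | (z <= y)%O]|.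
have [x0 x0s hmin] := @arg_minnP _ x (fun y => inr y \in s) h xs.
exists x0 => // y ys; have := sX _ _ x0s ys; rewrite /Order.comparable.
case/orP=> // yx0; have := hmin y ys; rewrite leqNgt; apply: contraNT => x0y.
apply: proper_card; apply/properP; split.
  by apply/subsetP=> z; rewrite !inE => zy; exact: le_trans zy yx0.
by exists x0; rewrite !inE.
Qed.

(** A vertex related to the least element of the chain is related to the whole chain by [R_up]. The
    vertex toggled depends on [xpart] only, which toggling preserves. *)
Lemma cylinder_bottom i :
  isomorphic (based_homology (ranked_incidence r) (@simplex_degree Y) bottom i)
             (based_homology (ranked_incidence r) (@simplex_degree Y) cylinder i)
  /\
  isomorphic (based_homology (transpose (ranked_incidence r))
                (fun s => - @simplex_degree Y s) bottom i)
             (based_homology (transpose (ranked_incidence r))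
                (fun s => - @simplex_degree Y s) cylinder i).
Proof.
(* Adding an element of [V] never changes the toggled vertex, so a change is due to an element of
   [X], which must outweigh the toggled element of [V]. *)
pose weight (y : Y) : nat := if y is inl _ then 1 else 2.
pose vertex (s : {set Y}) : option Y :=
  omap inl [pick v | [forall x in xpart s, R v x]].
have vertex_xpart s t : xpart s = xpart t -> vertex s = vertex t.
  by rewrite /vertex => ->.
have vertexP s : s \in cylinder -> (exists x, inr x \in s) ->
    exists2 v, vertex s = Some (inl v) & forall x, inr x \in s -> R v x.
  move=> sC [x xs]; have [x0 x0s x0min] := chain_min sC xs.
  have [v vx0] := R_total x0; rewrite /vertex; case: pickP => [w /forall_inP sw|].
    by exists w => // y ys; apply: sw; rewrite inE.
  move/(_ v)/negP; case; apply/forall_inP=> y; rewrite inE => ys.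
  by apply: R_up vx0 _; exact: x0min.
have EP s : s \in cylinder :\: bottom ->
    s \in cylinder /\ exists x, inr x \in s.
  rewrite inE => /andP[sB sC]; split=> //; apply/existsP; apply: contraNT sB.
  by move=> /existsPn sx; apply/bottomP.
have xpartU v s : xpart (inl v |: s) = xpart s.
  by apply/setP=> x; rewrite !inE.
have xpartD v s : xpart (s :\ inl v) = xpart s.
  by apply/setP=> x; rewrite !inE.
have xpart_toggle v s : xpart (toggle (inl v) s) = xpart s.
  by rewrite /toggle; case: ifP.
(* [odflt] needs a default in [Y]. If there is none, the cylinder and its bottom coincide. *)
have [y0|Y0] := pickP (@predT Y); last first.
  have -> : bottom = cylinder; last by split; exists idfun; exists id.
  apply/setP=> s; apply/bottomP/idP => [[]|sC] //; split=> // x.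
  by have := Y0 (inr x).
move=> _; apply: (@matched_isomorphic _ _ r_inj weight (odflt y0 \o vertex)) => //.
- by case.
- move=> s t /bottomP[sC sx] ts; apply/bottomP; split.
    exact: cylinder_down sC ts.
  by move=> x; apply: contra (sx x); exact: (subsetP ts).
- by apply/subsetP=> s /bottomP[].
split.
- apply: based_complex_incidence => // s t u /EP[sC _] /EP[_ [x xu]] ut ts.
  rewrite inE (cylinder_down sC ts) andbT; apply/bottomP => -[_ /(_ x)/negP].
  by apply; exact: (subsetP ut).
- move=> s /EP[sC xs]; have [v /= -> /= Rv] := vertexP s sC xs.
  have /cylinderP[sK sX sR] := sC.
  have memx x : (inr x \in toggle (inl v) s) = (inr x \in s).
    by have /setP/(_ x) := xpart_toggle v s; rewrite !inE.
  have memv w : inl w \in toggle (inl v) s -> w = v \/ inl w \in s.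
    rewrite /toggle; case: ifP => _; rewrite !inE; first by case/andP; right.
    by case/orP => [/eqP[->]|]; [left | right].
  have tR w x : inl w \in toggle (inl v) s -> inr x \in s -> R w x.
    by move/memv=> [-> /Rv|/sR/[apply]].
  rewrite inE; apply/andP; split.
    apply/bottomP=> -[_ tx]; case: xs => x xs.
    by have := tx x; rewrite memx xs.
  apply/cylinderP; split.
  + by case: xs => x xs; apply: (R_simplex (x := x)) => w; rewrite inE => /tR; apply.
  + by move=> x y; rewrite !memx; exact: sX.
  + by move=> w x wt; rewrite memx; exact: tR.
- move=> s /EP[sC xs]; have [v /= sv _] := vertexP s sC xs.
  by rewrite /= sv /= (vertex_xpart _ s) ?sv.
- move=> s y /EP[sC xs]; have [v /= sv _] := vertexP s sC xs.
  rewrite /= sv /= => _ _ _; case: y => // w.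
  by rewrite (vertex_xpart _ s) ?xpartU ?xpartD // sv eqxx.
Qed.

(** Dual to [cylinder_bottom]: the toggled element of [X] is the least one related to all of
    [vpart], and the weights are exchanged. *)
Lemma cylinder_top i :
  isomorphic (based_homology (ranked_incidence r) (@simplex_degree Y) top i)
             (based_homology (ranked_incidence r) (@simplex_degree Y) cylinder i)
  /\
  isomorphic (based_homology (transpose (ranked_incidence r))
                (fun s => - @simplex_degree Y s) top i)
             (based_homology (transpose (ranked_incidence r))
                (fun s => - @simplex_degree Y s) cylinder i).
Proof.
pose weight (y : Y) : nat := if y is inl _ then 2 else 1.
pose bounds (s : {set Y}) x := [forall v in vpart s, R v x].
pose vertex (s : {set Y}) : option Y :=
  omap inr [pick x | bounds s x && [forall (y | bounds s y), (x <= y)%O]].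
have vertex_vpart s t : vpart s = vpart t -> vertex s = vertex t.
  by rewrite /vertex /bounds => ->.
have boundsP s x : reflect (forall v, v \in vpart s -> R v x) (bounds s x).
  exact: forall_inP.
have vertexP s : s \in cylinder -> (exists v, inl v \in s) ->
    exists2 x, vertex s = Some (inr x) & bounds s x /\
      forall y, bounds s y -> (x <= y)%O.
  case/cylinderP=> sK _ _ [v vs].
  have [|x0 /boundsP Rx0 x0min] := R_sup sK.
    by apply/set0Pn; exists v; rewrite inE.
  rewrite /vertex; case: pickP => [x /andP[Rx /forall_inP xmin]|].
    by exists x.
  move/(_ x0); rewrite Rx0 /= => /negP; case; apply/forall_inP=> y.
  by move/boundsP; exact: x0min.
have EP s : s \in cylinder :\: top ->
    s \in cylinder /\ exists v, inl v \in s.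
  rewrite inE => /andP[sT sC]; split=> //; apply/existsP; apply: contraNT sT.
  by move=> /existsPn sv; apply/topP.
have vpartU x s : vpart (inr x |: s) = vpart s.
  by apply/setP=> v; rewrite !inE.
have vpartD x s : vpart (s :\ inr x) = vpart s.
  by apply/setP=> v; rewrite !inE.
have vpart_toggle x s : vpart (toggle (inr x) s) = vpart s.
  by rewrite /toggle; case: ifP.
have [y0|Y0] := pickP (@predT Y); last first.
  have -> : top = cylinder; last by split; exists idfun; exists id.
  apply/setP=> s; apply/topP/idP => [[]|sC] //; split=> // v.
  by have := Y0 (inl v).
move=> _; apply: (@matched_isomorphic _ _ r_inj weight (odflt y0 \o vertex)) => //.
- by case.
- move=> s t /topP[sC sv] ts; apply/topP; split.
    exact: cylinder_down sC ts.
  by move=> v; apply: contra (sv v); exact: (subsetP ts).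
- by apply/subsetP=> s /topP[].
split.
- apply: based_complex_incidence => // s t u /EP[sC _] /EP[_ [v vu]] ut ts.
  rewrite inE (cylinder_down sC ts) andbT; apply/topP => -[_ /(_ v)/negP].
  by apply; exact: (subsetP ut).
- move=> s /EP[sC vs]; have [x /= -> /= [/boundsP Rx xmin]] := vertexP s sC vs.
  have /cylinderP[sK sX sR] := sC.
  have memv v : (inl v \in toggle (inr x) s) = (inl v \in s).
    by have /setP/(_ v) := vpart_toggle x s; rewrite !inE.
  have memx y : inr y \in toggle (inr x) s -> y = x \/ inr y \in s.
    rewrite /toggle; case: ifP => _; rewrite !inE; first by case/andP; right.
    by case/orP => [/eqP[->]|]; [left | right].
  (* Every element of the chain is related to all of [vpart], hence lies above [x], so adding [x]
     leaves a chain. *)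
  have lex y : inr y \in s -> (x <= y)%O.
    by move=> ys; apply/xmin/boundsP => v; rewrite inE => vs'; exact: sR.
  rewrite inE; apply/andP; split.
    apply/topP=> -[_ tv]; case: vs => v vs.
    by have := tv v; rewrite memv vs.
  apply/cylinderP; split.
  + by rewrite vpart_toggle.
  + move=> y z /memx[->|ys] /memx[->|zs]; rewrite ?comparablexx //.
    * by rewrite le_comparable // lex.
    * by rewrite ge_comparable // lex.
    * exact: sX.
  + move=> v y; rewrite memv => vs' /memx[->|]; last exact: sR.
    by apply: Rx; rewrite inE.
- move=> s /EP[sC vs]; have [x /= sx _] := vertexP s sC vs.
  by rewrite /= sx /= (vertex_vpart _ s) ?sx.
- move=> s y /EP[sC vs]; have [x /= sx _] := vertexP s sC vs.
  rewrite /= sx /= => _ _ _; case: y => // z.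
  by rewrite (vertex_vpart _ s) ?vpartU ?vpartD // sx eqxx.
Qed.

Let bottom_inl i :
  isomorphic (based_homology (enum_incidence V) (@simplex_degree V) K i)
             (based_homology (ranked_incidence r) (@simplex_degree Y) bottom i)
  /\
  isomorphic (based_homology (transpose (enum_incidence V))
                (fun s => - @simplex_degree V s) K i)
             (based_homology (transpose (ranked_incidence r))
                (fun s => - @simplex_degree Y s) bottom i).
Proof.
apply: (@based_homology_imset _ _ _ _ inl) => //.
- by move=> v w [].
- move=> s sK; apply/bottomP; split=> [|x]; last by apply/imsetP=> -[].
  apply/cylinderP; split.
  + by rewrite /vpart (_ : _ @^-1: _ = s) //; apply/setP=> v;
      rewrite inE mem_imset // => a b [].
  + by move=> x y /imsetP[].
  + by move=> v x _ /imsetP[].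
- by move=> s /bottomP[/cylinderP[]].
- move=> s /bottomP[_ sx]; apply/setP=> -[v|x].
    by rewrite mem_imset ?inE // => a b [].
  by rewrite (negPf (sx x)); apply/imsetP=> -[].
Qed.

Let top_inr i :
  isomorphic (based_homology (enum_incidence X) (@simplex_degree X)
                (order_complex X) i)
             (based_homology (ranked_incidence r) (@simplex_degree Y) top i)
  /\
  isomorphic (based_homology (transpose (enum_incidence X))
                (fun s => - @simplex_degree X s) (order_complex X) i)
             (based_homology (transpose (ranked_incidence r))
                (fun s => - @simplex_degree Y s) top i).
Proof.
have inr_inj : injective (inr : X -> Y) by move=> x y [].
apply: (@based_homology_imset _ _ _ _ inr) => //.
- by move=> x y; rewrite /= ltn_add2l.
- move=> s; rewrite inE => /forall_inP sX.
  apply/topP; split=> [|v]; last by apply/imsetP=> -[].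
  apply/cylinderP; split.
  + by rewrite /vpart (_ : _ @^-1: _ = set0) //; apply/setP=> v;
      rewrite !inE; apply/imsetP=> -[].
  + move=> x y; rewrite !mem_imset // => xs ys.
    by have /forall_inP := sX x xs; apply.
  + by move=> v x /imsetP[].
- move=> s /topP[/cylinderP[_ sX _] _]; rewrite inE.
  by apply/forall_inP=> x; rewrite inE => xs; apply/forall_inP=> y;
    rewrite inE; exact: sX.
- move=> s /topP[_ sv]; apply/setP=> -[v|x]; last by rewrite mem_imset ?inE.
  by rewrite (negPf (sv v)); apply/imsetP=> -[].
Qed.

Lemma poset_homology_nerve i :
  isomorphic (poset_red_homology X i)
    (based_homology (enum_incidence V) (@simplex_degree V) K i).
Proof.
apply: (isomorphic_trans (red_homology_based _ _)).
apply: (isomorphic_trans (top_inr i).1).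
apply: (isomorphic_trans (cylinder_top i).1).
apply: isomorphic_sym.
exact: isomorphic_trans (bottom_inl i).1 (cylinder_bottom i).1.
Qed.

Lemma poset_cohomology_nerve i :
  isomorphic (poset_red_cohomology X i)
    (based_homology (transpose (enum_incidence V))
       (fun s => - @simplex_degree V s) K (- i)).
Proof.
apply: (isomorphic_trans (red_cohomology_based _ _)).
apply: (isomorphic_trans (top_inr _).2).
apply: (isomorphic_trans (cylinder_top _).2).
apply: isomorphic_sym.
exact: isomorphic_trans (bottom_inl _).2 (cylinder_bottom _).2.
Qed.

End Cylinder.

(** * Combinatorial Alexander duality *)

Section Complement.

Variables (T : finType) (r : T -> nat).
Hypothesis r_inj : injective r.

Let rank_sign (x : T) : int := (-1) ^+ #|[set y | (r y < r x)%N]|.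

(** The rescaling under which complementation turns the boundary into the coboundary. *)
Definition complement_sign (s : {set T}) : int := \prod_(x in s) rank_sign x.

Lemma complement_sign_sqr s : complement_sign s ^+ 2 = 1.
Proof.
by rewrite -prodrXl big1 // => x _; rewrite /rank_sign sqrr_sign.
Qed.

(** For [t = s :\ x], the elements of [s] before [x] and those of [~: t] before [x] together are all
    elements of [T] before [x]. So the two incidences multiply to [rank_sign x], which is the
    product of both complement signs. *)
Lemma ranked_incidence_setC (s t : {set T}) :
  ranked_incidence r (~: t) (~: s) =
  complement_sign s * complement_sign t * ranked_incidence r s t.
Proof.
have [st|/existsP nst] := boolP [exists x in s, t == s :\ x].
  have /exists_inP[x xs /eqP ->] := st.
  have xt : x \in ~: (s :\ x) by rewrite !inE eqxx.
  have -> : ~: s = ~: (s :\ x) :\ x.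
    by apply/setP=> y; rewrite !inE; case: (eqVneq y x) => [->|]; rewrite ?xs.
  rewrite !ranked_incidence_facet // /complement_sign (big_setD1 x xs) /=.
  rewrite -/(complement_sign (s :\ x)) -mulrA mulrA -[X in _ = X * _]mulrA.
  rewrite -expr2 complement_sign_sqr mulr1 /rank_sign /position_sign -exprD.
  set a := #|_|; set b := #|_|; set c := #|_|.
  have -> : b = (a + c)%N.
    rewrite /b -(cardsID s) addnC; congr (_ + _)%N; apply: eq_card => y.
      by rewrite !inE; case: (eqVneq y x) => [->|_]; rewrite ?ltnn ?andbF.
    by rewrite !inE andbC.
  by rewrite -addnA addnn exprD -[_ ^+ c.*2]signr_odd odd_double mulr1.
have [->|/ranked_incidence_neq0[x xs ts]] := eqVneq (ranked_incidence r s t) 0.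
  have [->|/ranked_incidence_neq0[x xt ts]] :=
    eqVneq (ranked_incidence r (~: t) (~: s)) 0; first by rewrite mulr0.
  case: nst; exists x; move: xt; rewrite inE => xt.
  have -> : s = x |: t by rewrite -[s]setCK ts setCD setCK setUC.
  by rewrite setU11 setU1K ?eqxx.
by case: nst; exists x; rewrite xs ts eqxx.
Qed.

(** The full simplex is a cone with apex [x]: toggling [x] matches everything. A vertex must exist,
    since the empty simplex alone is not acyclic. *)
Lemma acyclic_full (x : T) :
  acyclic (ranked_incidence r) [set: {set T}].
Proof.
have mT : matched r (fun=> 1%N) (fun=> x) [set: {set T}].
  split=> //; first by apply: based_complex_incidence => // *; rewrite inE.
    by move=> s _; rewrite inE.
  by move=> s y _ _ _ _; rewrite eqxx.
by have [] := matched_acyclic (weight := fun=> 1%N) (fun=> isT) mT.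
Qed.

Lemma combinatorial_alexander_duality (K : {set {set T}}) (i : int) :
  (forall s t : {set T}, s \in K -> t \subset s -> t \in K) ->
  set0 \in K -> setT \notin K ->
  isomorphic
    (based_homology (ranked_incidence r) (@simplex_degree T) K i)
    (based_homology (transpose (ranked_incidence r))
       (fun s => - @simplex_degree T s) (alexander_dual K)
       (- (#|T|%:Z - i - 3))).
Proof.
move=> K_down K0 KT.
have [x _] : exists x : T, x \in [set: T].
  by apply/set0Pn; apply: contra KT => /eqP->.
apply: (@isomorphic_trans _
  (based_homology (ranked_incidence r) (@simplex_degree T) (~: K) (i + 1))).
  apply: isomorphic_sym.
  apply: (@based_homology_connecting _ _ K (~: K) [set: {set T}]).
  - by rewrite setUCr.
  - by rewrite disjoint_sym disjoints_subset.
  - move=> s t sK; rewrite inE => tK.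
    have [//|/ranked_incidence_neq0[y _ ts]] := eqVneq (ranked_incidence r s t) 0.
    by case/negP: tK; apply: K_down sK _; rewrite ts subD1set.
  - by apply: based_complex_incidence => // *; rewrite inE.
  - exact: ranked_incidence_homogeneous.
  - exact: acyclic_full.
apply: (@based_homology_relabel _ _ _ _ _ _ _ _ _ _ (@setC T) (@setC T)
  complement_sign).
- by move=> s; rewrite !inE setCK.
- by move=> s; rewrite !inE.
- by move=> s _; rewrite setCK.
- by move=> s _; rewrite setCK.
- exact: complement_sign_sqr.
- by move=> s t _ _; exact: ranked_incidence_setC.
(* A non-simplex of dimension [i + 1] has [i + 2] vertices, so its complement has dimension
   [#|T| - i - 3]. *)
- move=> s _; rewrite /simplex_degree; have := cardsC s; lia.
Qed.

End Complement.

(** * Reduced lattices *)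

Lemma isomorphic_trivial (A B : zmodType) :
  isomorphic A B -> (forall y : B, y = 0) -> forall x : A, x = 0.
Proof.
by case=> f [g fK _] B0 x; rewrite -[x]fK (B0 (f x)) -(B0 (f 0)) fK.
Qed.

(** The only possible simplex is the empty one, in degree -1. *)
Lemma red_cohomology_empty_type (T : finType) (K : {set {set T}}) (i : int) :
  (T -> False) -> i <> -1 -> forall h : red_cohomology K i, h = 0.
Proof.
move=> T0 i1; apply: (isomorphic_trivial (red_cohomology_based K i)).
apply: empty_degree_trivial => s _; have -> : s = set0.
  by apply/setP=> x; case: (T0 x).
by rewrite /simplex_degree cards0; lia.
Qed.

(** * Cohomology of face posets *)

Section DualNerve.

Variables (V : finType) (K : {set {set V}}).

(** The relation is membership: the least simplex containing all vertices of [s] is [s] itself. *)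
Lemma face_poset_cohomology (i : int) :
  (forall s t : {set V}, s \in K -> t \subset s -> t \in K) -> set0 \in K ->
  isomorphic (poset_red_cohomology (face_poset K) i)
    (based_homology (transpose (enum_incidence V))
       (fun s => - @simplex_degree V s) K (- i)).
Proof.
move=> K_down K0.
have leE (x y : face_poset K) : (x <= y)%O = (val x \subset val y).
  exact: (@Order.SetSubsetOrder.leEsubset
    Order.SetSubsetOrder.subset_display _ (val x) (val y)).
apply: (@poset_cohomology_nerve _ _ _ _ (fun v (x : face_poset K) => v \in val x)).
- exact: K_down.
- exact: K0.
- by move=> v x y vx; rewrite leE => /subsetP; apply.
- by move=> x; have /andP[_ /set0Pn] := valP x.
- move=> s x sx; have /andP[xK _] := valP x.
  by apply: K_down xK _; apply/subsetP.
- move=> s sK s0; have sP : (s \in K) && (s != set0) by rewrite sK.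
  exists (Sub s sP : face_poset K) => [v|y sy]; first by rewrite SubK.
  by rewrite leE SubK; apply/subsetP.
Qed.

End DualNerve.

(** * The complex [T(X)] of a reduced lattice *)

Section MinimalElements.

Variables (d : Order.disp_t) (X : finPOrderType d).
Variables (V : finType) (incl : minimal_elt X -> V).

(** An element of [V] outside the image of [incl] is related to nothing, so it is never a vertex of
    [T_complex_in]. *)
Definition above (v : V) (x : X) : bool :=
  [exists m, (incl m == v) && (val m <= x)%O].

Lemma minimal_below (x : X) : exists m : minimal_elt X, (val m <= x)%O.
Proof.
pose h (y : X) := #|[set z : X | (z <= y)%O]|.
have [m mx mmin] := @arg_minnP _ x (fun y => (y <= x)%O) h (lexx x).
suff mP : m \in minimals X by exists (Sub m mP).
rewrite inE; apply/forall_inP=> y ym; apply: contraT => yNm.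
have := mmin y (le_trans ym mx); rewrite leqNgt => /negP; case.
apply: proper_card; apply/properP; split.
  by apply/subsetP=> z; rewrite !inE => zy; exact: le_trans zy ym.
exists m; rewrite !inE //; apply: contra yNm => my.
by rewrite eq_le ym my.
Qed.

Hypothesis incl_inj : injective incl.

Lemma T_complex_inP (s : {set V}) :
  s \in T_complex_in incl <->
  s = set0 \/ exists x, forall v, v \in s -> above v x.
Proof.
split=> [/imsetP[t]|].
  rewrite inE => /orP[/eqP-> ->|/existsP[x /forall_inP tx] ->].
    by left; rewrite imset0.
  right; exists x => v /imsetP[m mt ->]; apply/existsP; exists m.
  by rewrite eqxx tx.
case=> [->|[x sx]].
  by apply/imsetP; exists set0; rewrite ?imset0 // inE eqxx.
apply/imsetP; exists (incl @^-1: s).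
  rewrite inE; apply/orP; right; apply/existsP; exists x.
  apply/forall_inP=> m; rewrite inE => /sx /existsP[m' /andP[/eqP]].
  by move/incl_inj->.
apply/setP=> v; apply/idP/imsetP => [vs|[m]]; last by rewrite inE => ms ->.
have /existsP[m /andP[/eqP mv _]] := sx v vs.
by exists m; rewrite ?inE mv.
Qed.

Lemma set0_T_complex_in : set0 \in T_complex_in incl.
Proof. by apply/T_complex_inP; left. Qed.

Lemma T_complex_in_down (s t : {set V}) :
  s \in T_complex_in incl -> t \subset s -> t \in T_complex_in incl.
Proof.
move=> /T_complex_inP sT /subsetP ts; apply/T_complex_inP.
case: sT => [s0|[x sx]]; last by right; exists x => v /ts /sx.
by left; apply/setP=> v; rewrite inE; apply/negP=> /ts; rewrite s0 inE.
Qed.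

Lemma reduced_lattice_homology (i : int) : reduced_lattice X ->
  isomorphic (poset_red_homology X i)
    (based_homology (enum_incidence V) (@simplex_degree V)
       (T_complex_in incl) i).
Proof.
move=> hX; apply: (@poset_homology_nerve _ _ _ _ above).
- exact: T_complex_in_down.
- exact: set0_T_complex_in.
- move=> v x y /existsP[m /andP[mv mx]] xy; apply/existsP; exists m.
  by rewrite mv (le_trans mx xy).
- move=> x; have [m mx] := minimal_below x; exists (incl m).
  by apply/existsP; exists m; rewrite eqxx.
- by move=> s x sx; apply/T_complex_inP; right; exists x.
- move=> s /T_complex_inP[->|[u su] s0]; first by rewrite eqxx.
  (* The join of s is the infimum of its set of upper bounds. *)
  pose U := [set y | [forall v in s, above v y]].
  (* This bounds [U] below when [s] is non-empty, and later puts the infimum of [U] above all of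
     [s]. *)
  have Um m : incl m \in s -> lower_bound U (val m).
    move=> ms y; rewrite inE => /forall_inP/(_ _ ms)/existsP[m' /andP[/eqP]].
    by move/incl_inj->.
  have sm v : v \in s -> exists2 m, incl m = v & lower_bound U (val m).
    move=> vs; have /existsP[m /andP[/eqP mv _]] := su v vs.
    by exists m => //; apply: Um; rewrite mv.
  have [||x [xU xmax]] := hX U.
  + by apply/set0Pn; exists u; rewrite inE; apply/forall_inP.
  + by have /set0Pn[v /sm[m _ mU]] := s0; exists (val m).
  exists x => [v /sm[m mv /xmax mx]|y sy].
    by apply/existsP; exists m; rewrite mv eqxx.
  by apply: xU; rewrite inE; apply/forall_inP.
Qed.

End MinimalElements.

Theorem proposition3p5 (d : Order.disp_t) (X : finPOrderType d)
    (hX : reduced_lattice X)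
    (V : finType) (incl : minimal_elt X -> V) (incl_inj : injective incl)
    (i : int)
    (hVi : [set: V] \in T_complex_in incl ->
       i <> #|V|%:Z - 2 /\ (#|V| = 0%N -> i <> -1)) :
  isomorphic (poset_red_homology X i)
    (poset_red_cohomology (poset_alexander_dual incl) (#|V|%:Z - i - 3)).
Proof.
set K := T_complex_in incl in hVi *.
have K_down (s t : {set V}) : s \in K -> t \subset s -> t \in K.
  exact: T_complex_in_down.
have K0 : set0 \in K by exact: set0_T_complex_in.
have r_inj : injective (fun x : V => enum_rank x : nat).
  by move=> x y /val_inj/enum_rank_inj.
have HX := reduced_lattice_homology incl_inj i hX.
have [KT|KT] := boolP ([set: V] \in K); last first.
  apply: (isomorphic_trans HX).
  apply: (isomorphic_trans (combinatorial_alexander_duality r_inj _ K_down K0 KT)).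
  apply: isomorphic_sym; apply: face_poset_cohomology => [s t|].
    rewrite !inE => sK ts; apply: contra sK => /K_down; apply.
    by rewrite setCS.
  by rewrite inE setC0.
(* [K] is now the full simplex and both sides vanish. On the left, either [V] is non-empty and [K]
   acyclic, or homology sits in degree -1, excluded by [i1]. On the right, the dual poset is empty,
   and [i2] keeps the degree away from -1. *)
have [i2 i1] := hVi KT; have KE : K = [set: {set V}].
  by apply/setP=> s; rewrite inE; apply: K_down KT (subsetT s).
apply: trivial_isomorphic.
  apply: (isomorphic_trivial HX); rewrite -/K KE.
  have [V0|/card_gt0P[x _]] := posnP #|V|.
    apply: empty_degree_trivial => s _; have := max_card (mem s).
    by rewrite V0 leqn0 /simplex_degree => /eqP ->; have := i1 V0; lia.
  by apply: acyclic_trivial; exact: acyclic_full r_inj x.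
apply: red_cohomology_empty_type; last lia.
by case=> s /=; rewrite inE -/K KE inE.
Qed.
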